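(* Let $p\in(1,2]$, let $m\in\mathbb{N}$, and let $t_1,\ldots,t_m$ be distinct real numbers. For $n\in\mathbb{N}$ let $\mathcal{D}_{n,m}^p$ be the set of Dirichlet polynomials $B(s)=\sum_{k=1}^n b_kk^{-s}$, $b_k\in\mathbb{C}$, satisfying $B(1/p+it_j)=1$ for $j=1,\ldots,m$, and let $$d_{n,m,p}^2=\inf_{B\in\mathcal{D}_{n,m}^p}\frac{1}{2\pi}\int_{\Re(s)=1/p}\left|\frac{B(s)}{s}\right|^2|ds| .$$ Then there exists $n(m)\in\mathbb{N}$ such that, for every $n>n(m)$, there is a unique $\tilde B_{n,p}\in\mathcal{D}_{n,m}^p$ for which this infimum is attained. Moreover, $$d_{n,m,p}^2\sim\frac{1}{\log n}\sum_{j=1}^m\frac{1}{1/p^2+t_j^2}\qquad\text{as } n\to\infty.$$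
   Context: The notation $\int_{\Re(s)=1/p}F(s)\,|ds|$ means $\int_{-\infty}^{\infty}F(1/p+it)\,dt$. The notation $f(n)\sim g(n)$ as $n\to\infty$ means $f(n)/g(n)\to1$; here $p$, $m$ and $t_1,\ldots,t_m$ are fixed. The integer $n(m)$ may depend on $p$ and $t_1,\ldots,t_m$ as well as on $m$. *)

(* Defs.v *)
From HB Require Import structures.
From mathcomp Require Import all_boot all_order all_algebra.
From mathcomp Require Import all_classical all_reals all_analysis.
From mathcomp Require Import complex.

Set Implicit Arguments.
Unset Strict Implicit.
Unset Printing Implicit Defensive.

Import Order.TTheory GRing.Theory Num.Theory.
Import numFieldNormedType.Exports.

Local Open Scope classical_set_scope.
Local Open Scope complex_scope.
Local Open Scope ring_scope.

Definition cexp (R : realType) (z : R[i]) : R[i] :=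
  (expR (complex.Re z) * cos (complex.Im z)) +i* (expR (complex.Re z) * sin (complex.Im z)).

(* k^{-s} = exp (- s log k); only meaningful for 0 < k. *)
Definition nat_cpow_opp (R : realType) (k : nat) (s : R[i]) : R[i] :=
  cexp (- s * (ln (k%:R : R))%:C).

Definition dirichlet_poly (R : realType) (n : nat) (b : nat -> R[i])
    (s : R[i]) : R[i] :=
  \sum_(1 <= k < n.+1) b k * nat_cpow_opp k s.

(* Elements are functions of s, so uniqueness of an element is uniqueness as a
   function, independently of the coefficients b_k with k = 0 or k > n. *)
Definition dirichlet_interp (R : realType) (p : R) (m : nat) (t : 'I_m -> R)
    (n : nat) : set (R[i] -> R[i]) :=
  [set B | (exists b : nat -> R[i], B = dirichlet_poly n b) /\
           (forall j : 'I_m, B (p^-1 +i* t j) = 1)].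

(* The integral of a real-valued F over the line Re s = c, with respect to
   |ds|; as an extended real it is meaningful for every nonnegative
   measurable F. *)
Definition line_integral (R : realType) (c : R) (F : R[i] -> R) : \bar R :=
  (\int[lebesgue_measure]_(u in [set: R]) (F (c +i* u))%:E)%E.

Definition energy (R : realType) (p : R) (B : R[i] -> R[i]) : \bar R :=
  (((2 * pi)^-1)%:E *
     line_integral p^-1 (fun s => (Normc.normc (B s / s) ^+ 2)%R))%E.

(* d_{n,m,p}^2, the infimum in [0, +oo]; it is +oo when no Dirichlet polynomial
   of length n interpolates. *)
Definition dist2 (R : realType) (p : R) (m : nat) (t : 'I_m -> R) (n : nat)
    : \bar R :=
  ereal_inf [set energy p B | B in dirichlet_interp p t n].

(* u n / v n tends to 1; if so, u n is eventually finite. *)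
Definition asymp_equiv (R : realType) (u : nat -> \bar R) (v : nat -> R)
    : Prop :=
  (u n * ((v n)^-1)%:E)%E @[n --> \oo] --> 1%:E.

(* Main.v *)
(* Put c = 1/p and S_k = b_1 + ... + b_k. Since
   (1/2pi) int e^(-iau) / (c^2 + u^2) du = e^(-c|a|) / (2c), the monomials k^-s
   have inner products max(k, l)^(-2c) / (2c), so that the energy of B is
   diagonal in the partial sums: it equals sum_k w_k |S_k|^2, where w_k is the
   integral of y^(-2c-1) over [k, k+1] (over [n, +oo[ for k = n). By Abel
   summation B(s) = sum_k S_k a_k(s) with a_k(s) = k^-s - (k+1)^-s and
   a_n(s) = n^-s. Hence d_n^2 is the squared norm of the shortest vector
   satisfying m linear equations, which is the sum of the entries of G^-1 1
   for the Gram matrix G_ij = sum_k a_k(s_i) conj(a_k(s_j)) / w_k.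
   Its terms are (log(k+1) - log k) k^(-i(t_i - t_j)) (s_i conj(s_j) + o(1)), so
   G / log n tends to the diagonal matrix with entries |s_i|^2: for i <> j the
   oscillating sums are bounded up to o(log n) by telescoping. The Fourier
   integral is found by solving F'' = c^2 F for F(a) = int cos(au) / (c^2 + u^2). *)
Require Import Defs.
From HB Require Import structures.
From mathcomp Require Import all_boot all_order all_algebra.
From mathcomp Require Import all_classical all_reals all_analysis.
From mathcomp Require Import complex.
From mathcomp Require Import measurable_realfun ring lra.

Set Implicit Arguments.
Unset Strict Implicit.
Unset Printing Implicit Defensive.

Import Order.TTheory GRing.Theory Num.Theory.
Import numFieldNormedType.Exports.

Local Open Scope classical_set_scope.
Local Open Scope ring_scope.

(** * The Fourier transform of 1 / (c^2 + u^2) *)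

Section fourier_cauchy.
Context {R : realType}.
Let mu : {measure set _ -> \bar R} := @lebesgue_measure R.
Implicit Types (a c u x : R).

Lemma integralT_scale (G : R -> R) a : 0 < a -> continuous G ->
  (forall x, 0 <= G x) ->
  (\int[mu]_x (G x)%:E = \int[mu]_x (a * G (a * x))%:E)%E.
Proof.
move=> a0 cG G0.
have dF : derive1 (fun x : R => a * x) = cst a.
  by apply/funext => x; rewrite derive1Ml// derive1_id mulr1.
rewrite (@increasing_ge0_integration_by_substitutionT R (fun x => a * x) G) //.
- by apply: eq_integral => x _; rewrite /= fctE/= dF /= mulrC.
- by move=> x y xy; rewrite ltr_pM2l.
- by rewrite dF => x; exact: cvg_cst.
- by rewrite dF; exact: is_cvg_cst.
- by rewrite dF; exact: is_cvg_cst.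
- by apply: gt0_cvgMrNy => //; exact: cvg_id.
- by apply: gt0_cvgMry => //; exact: cvg_id.
Qed.

Lemma add_sqr_gt0 c u : 0 < c -> 0 < c ^+ 2 + u ^+ 2.
Proof. by move=> c0; rewrite ltr_pwDl ?exprn_gt0 ?sqr_ge0. Qed.

Lemma continuous_add_sqrV c : 0 < c -> continuous (fun u => (c ^+ 2 + u ^+ 2)^-1).
Proof.
move=> c0 u; apply: cvgV; first by rewrite gt_eqF ?add_sqr_gt0.
by apply: cvgD; [exact: cvg_cst|exact: exprn_continuous].
Qed.

(** The integrand is even, and on the half line it has the antiderivative [c^-1 * atan (c^-1 * u)],
    which rises from 0 to pi / (2c). *)
Lemma integral_add_sqrV c : 0 < c ->
  (\int[mu]_u ((c ^+ 2 + u ^+ 2)^-1)%:E = (pi / c)%:E)%E.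
Proof.
move=> c0; rewrite ge0_symfun_integralT; last first.
- by move=> u /=; rewrite sqrrN.
- exact: continuous_add_sqrV.
- by move=> u; rewrite invr_ge0 ltW ?add_sqr_gt0.
have -> : [set x : R | 0 <= x] = `[0, +oo[%classic.
  by apply/seteqP; split => x/=; rewrite in_itv/= andbT.
have dat u : is_derive u 1 (fun v => c^-1 * atan (c^-1 * v)) ((c ^+ 2 + u ^+ 2)^-1).
  have h1 : is_derive u 1 (fun v => c^-1 * v) c^-1.
    by apply: is_derive_eq (is_deriveZ c^-1 (is_derive_id u 1)) _; rewrite scaler1.
  have h2 := is_derive1_comp (is_derive1_atan (c^-1 * u)) h1.
  apply: is_derive_eq (is_deriveZ c^-1 h2) _; rewrite /GRing.scale/=.
  have ? := add_sqr_gt0 u c0.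
  by field; rewrite !gt_eqF// mul1r.
rewrite (@ge0_continuous_FTC2y R _ (fun v => c^-1 * atan (c^-1 * v)) 0 (c^-1 * (pi / 2))).
- rewrite mulr0 atan0 mulr0 sube0 -EFinM; congr EFin; field.
  by rewrite gt_eqF.
- by move=> u _; rewrite invr_ge0 ltW ?add_sqr_gt0.
- by apply: continuous_subspaceT; exact: continuous_add_sqrV.
- apply: cvgM; first exact: cvg_cst.
  apply: (cvg_comp (fun v => c^-1 * v) (@atan R)); last exact: cvgy_atan.
  by apply: gt0_cvgMry; [rewrite invr_gt0|exact: cvg_id].
- by move=> u _; exact: ex_derive.
- apply: cvg_at_right_filter.
  have h : derivable (fun v => c^-1 * atan (c^-1 * v)) 0 1 by exact: ex_derive.
  by move/derivable1_diffP/differentiable_continuous : h.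
- by move=> u _; rewrite derive1E derive_val.
Qed.

Lemma integrable_add_sqrV c : 0 < c ->
  mu.-integrable setT (EFin \o (fun u => (c ^+ 2 + u ^+ 2)^-1)).
Proof.
move=> c0; apply/integrableP; split.
  by apply/measurable_EFinP; apply: continuous_measurable_fun; exact: continuous_add_sqrV.
rewrite (_ : (fun x : R => _) = fun u => ((c ^+ 2 + u ^+ 2)^-1)%:E) ?integral_add_sqrV ?ltry//.
by apply/funext => u /=; rewrite ger0_norm// invr_ge0 ltW// add_sqr_gt0.
Qed.

(** The common integrability criterion for the kernels below: all of them are bounded by a multiple
    of the Cauchy kernel. *)
Lemma integrable_dominated c (M : R) (f : R -> R) : 0 < c -> measurable_fun setT f ->
  (forall u, `|f u| <= M * (c ^+ 2 + u ^+ 2)^-1) ->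
  mu.-integrable setT (EFin \o f).
Proof.
move=> c0 mf fM; apply: (@le_integrable _ _ _ mu setT measurableT _
  (fun u => M%:E * ((c ^+ 2 + u ^+ 2)^-1)%:E)%E).
- exact/measurable_EFinP.
- move=> u _ /=; rewrite lee_fin (le_trans (fM u))//; exact: ler_norm.
- by apply: integrableZl => //; exact: integrable_add_sqrV.
Qed.
End fourier_cauchy.

(** * Kernels singular at the origin and the Fejér integral *)

Section fourier_cauchy_transform.
Context {R : realType}.
Let mu : {measure set _ -> \bar R} := @lebesgue_measure R.
Implicit Types (a c u x : R).

Lemma is_derive_continuous (f : R -> R) x (l : R) :
  is_derive x 1 f l -> {for x, continuous f}.
Proof. by case=> /derivable1_diffP/differentiable_continuous. Qed.

(** Meant for kernels with u^2 in the denominator: their default value at 0 may break continuity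
    there, but a single point does not affect measurability. *)
Lemma measurable_fun_punctured (f : R -> R) :
  (forall u, u != 0 -> {for u, continuous f}) -> measurable_fun setT f.
Proof.
move=> cf; rewrite -(setUv [set (0 : R)]).
apply/measurable_funU => //; first exact: measurableC.
split; first exact: measurable_fun_set1.
apply: open_continuous_measurable_fun.
  by apply: closed_openC; exact: closed_eq.
by move=> u; rewrite inE => /= /eqP; exact: cf.
Qed.

(** The origin is a null set, so kernel identities that require division by u may be used under the
    integral. *)
Lemma Rintegral_punctured (f g : R -> R) : measurable_fun setT f ->
  measurable_fun setT g -> (forall u, u != 0 -> f u = g u) ->
  (\int[mu]_u f u = \int[mu]_u g u).
Proof.
move=> mf mg fg; congr fine; apply: ae_eq_integral => //; [exact/measurable_EFinP..|].
exists [set 0]; split => //; first exact: lebesgue_measure_set1.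
move=> u /= /not_implyP[_ h]; apply/eqP/negPn/negP => u0; apply: h.
by rewrite fg.
Qed.

Lemma le_norm_sin x : `|sin x| <= `|x|.
Proof.
wlog x0 : x / 0 <= x.
  move=> H; have [|/ltW] := leP 0 x; first exact: H.
  by rewrite -oppr_ge0 => /H; rewrite sinN !normrN.
have [|z _] := @MVT_segment R sin cos 0 x x0 (fun y _ => is_derive_sin y).
  by apply: continuous_subspaceT; exact: continuous_sin.
rewrite sin0 !subr0 => ->; rewrite normrM ler_piMl// cos_max//.
Qed.

Lemma onem_cosE x : 1 - cos x = 2 * sin (x / 2) ^+ 2.
Proof.
rewrite -[in LHS](divfK (_ : (2 : R) != 0) x)// mulr_natr cos_mulr2n.
by rewrite cos2sin2; ring.
Qed.

Lemma onem_cos_ge0 x : 0 <= 1 - cos x.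
Proof. by rewrite subr_ge0 cos_le1. Qed.

Lemma onem_cos_le x : 1 - cos x <= x ^+ 2 / 2.
Proof.
rewrite onem_cosE; have := le_norm_sin (x / 2).
rewrite -ler_sqr ?nnegrE// !real_normK ?num_real//; lra.
Qed.

Lemma continuous_cosM a : continuous (fun u => cos (a * u)).
Proof.
move=> u; apply: continuous_comp; last exact: continuous_cos.
by apply: cvgM; [exact: cvg_cst|exact: cvg_id].
Qed.

(** The value 1 at the origin makes it continuous, as the change of variables in [integralT_scale]
    demands of its integrand. *)
Definition sinc x : R := if x == 0 then 1 else sin x / x.

Lemma continuous_sinc : continuous sinc.
Proof.
move=> x; have [->|x0] := eqVneq x 0.
  apply/continuous_withinNx; rewrite /sinc eqxx.
  have [/= + h] := is_derive_sin (0 : R).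
  rewrite /derivable => /cvgP; rewrite -/(derive _ _ _) h cos0.
  apply: cvg_trans; apply: near_eq_cvg; near=> y.
  have y0 : y != 0 by near: y; exact: nbhs_dnbhs_neq.
  by rewrite (negbTE y0) sin0 subr0 /GRing.scale/= mulr1 addr0 mulrC.
have : {for x, continuous (fun y => sin y / y)}.
  by apply: cvgM; [exact: continuous_sin|exact: cvgV].
rewrite /continuous_at (_ : sinc x = sin x / x); last by rewrite /sinc (negbTE x0).
apply: cvg_trans.
apply: near_eq_cvg; near=> y; rewrite /sinc ifF//; apply/negbTE.
by near: y; exact: (cvgr_neq0 (f := id)) x0.
Unshelve. all: end_near. Qed.

Lemma fejer_kernelE x : x != 0 -> 2^-1 * sinc (x / 2) ^+ 2 = (1 - cos x) / x ^+ 2.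
Proof.
move=> x0; rewrite onem_cosE /sinc mulf_eq0 (negbTE x0) invr_eq0 pnatr_eq0 /=.
by field.
Qed.

Lemma measurable_fejer a : measurable_fun setT (fun u : R => (1 - cos (a * u)) / u ^+ 2).
Proof.
apply: measurable_fun_punctured => u u0; apply: cvgM.
  by apply: cvgB; [exact: cvg_cst|exact: continuous_cosM].
by apply: cvgV; [rewrite expf_neq0|exact: exprn_continuous].
Qed.

Lemma integrable_fejer a :
  mu.-integrable setT (EFin \o (fun u : R => (1 - cos (a * u)) / u ^+ 2)).
Proof.
(* In (1 - cos(au)) (1 + u^2), the first product is at most a^2 u^2 / 2 and the second at most 2
   u^2; this gives the constant. *)
apply: (@integrable_dominated _ 1 (a ^+ 2 / 2 + 2)) => //.
  exact: measurable_fejer.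
move=> u; have [->|u0] := eqVneq u 0.
  rewrite mulr0 cos0 subrr mul0r normr0.
  by rewrite divr_ge0// ?addr_ge0 ?divr_ge0 ?sqr_ge0.
have u2 : 0 < u ^+ 2 by rewrite exprn_even_gt0.
rewrite ger0_norm ?divr_ge0 ?onem_cos_ge0 ?sqr_ge0//.
rewrite ler_pdivlMr ?add_sqr_gt0// mulrAC ler_pdivrMr//.
have h1 := onem_cos_le (a * u); have h2 := cos_geN1 (a * u).
rewrite exprMn in h1; nra.
Qed.

(** The substitution u -> a u makes the integral linear in [a]. The differential equation below uses
    this linearity, whatever the value of [K]. *)
Lemma integral_fejer : exists K : R, forall a, 0 <= a ->
  \int[mu]_u ((1 - cos (a * u)) / u ^+ 2) = a * K.
Proof.
pose G x := 2^-1 * sinc (x / 2) ^+ 2.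
have cG : continuous G.
  move=> x; apply: cvgM; first exact: cvg_cst.
  apply: (@cvg_comp _ _ _ (fun x => sinc (x / 2)) (fun y : R => y ^+ 2)); last exact: exprn_continuous.
  apply: (cvg_comp (fun x => x / 2) sinc); last exact: continuous_sinc.
  by apply: cvgM; [exact: cvg_id|exact: cvg_cst].
have G0 x : 0 <= G x by rewrite mulr_ge0// sqr_ge0.
exists (fine (\int[mu]_u (G u)%:E)) => a; rewrite le_eqVlt => /predU1P[<-|a0].
  rewrite mul0r; under eq_Rintegral do rewrite mul0r cos0 subrr mul0r.
  by rewrite Rintegral_cst// mul0r.
rewrite (integralT_scale a0 cG G0) -/(Rintegral _ _ _).
have mG : measurable_fun setT (fun u => a * G (a * u)).
  apply: continuous_measurable_fun => x; apply: cvgM; first exact: cvg_cst.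
  apply: continuous_comp; last exact: cG.
  by apply: cvgM; [exact: cvg_cst|exact: cvg_id].
rewrite -(@Rintegral_punctured (fun u => a^-1 * ((1 - cos (a * u)) / u ^+ 2)) (fun u => a * G (a * u))) //.
- by rewrite RintegralZl//; [rewrite mulrA mulfV ?gt_eqF ?mul1r|exact: integrable_fejer].
- by apply: measurable_funM => //; exact: measurable_fejer.
- move=> u u0; rewrite /G fejer_kernelE; last by rewrite mulf_neq0// (gt_eqF a0).
  by rewrite exprMn; field; rewrite u0 (gt_eqF a0).
Qed.

End fourier_cauchy_transform.

(** * Cosine and sine transforms of the Cauchy kernel *)

Section cos_transform.
Context {R : realType}.
Let mu : {measure set _ -> \bar R} := @lebesgue_measure R.
Implicit Types (a c u x : R).

(** Dominated differentiation, with a multiple of the Cauchy kernel as majorant on the interval of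
    radius 1 around [a]. *)
Lemma is_derive_under_integral (f df : R -> R -> R) a c (M : R) : 0 < c -> 0 <= M ->
  (forall x, mu.-integrable setT (EFin \o f x)) ->
  (forall x u, is_derive x 1 (f ^~ u) (df x u)) ->
  (forall x u, x \in `]a - 1, a + 1[ -> `|df x u| <= M / (c ^+ 2 + u ^+ 2)) ->
  is_derive a 1 (fun x => \int[mu]_u f x u) (\int[mu]_u df a u).
Proof.
move=> c0 M0 intf dff dfM.
have aI : `]a - 1, a + 1[%classic a by rewrite /= in_itv/= ltrDl ltrBlDr ltrDl ltr01.
have pE x u : partial1of2 f x u = df x u.
  by rewrite partial1of2E; have [_ ->] := dff x u.
have G0 u : 0 <= M / (c ^+ 2 + u ^+ 2).
  by rewrite divr_ge0// ltW// add_sqr_gt0.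
have iG : mu.-integrable setT (EFin \o (fun u => M / (c ^+ 2 + u ^+ 2))).
  apply: (@integrable_dominated _ c M) => //.
    apply: measurable_funM => //; apply: continuous_measurable_fun.
    exact: continuous_add_sqrV.
  by move=> u; rewrite ger0_norm.
have df1 x u : `]a - 1, a + 1[%classic x -> [set: R] u -> derivable (f ^~ u) x 1.
  by move=> _ _; have [] := dff x u.
have pM x u : `]a - 1, a + 1[%classic x -> [set: R] u ->
    `|partial1of2 f x u| <= M / (c ^+ 2 + u ^+ 2).
  by move=> xa _; rewrite pE; exact: dfM.
apply: DeriveDef.
  exact: (derivable_under_integral measurableT aI (fun x _ => intf x) df1 G0 iG pM).
rewrite -derive1E
  (differentiation_under_integral measurableT aI (fun x _ => intf x) df1 G0 iG pM).
by apply: eq_Rintegral => u _; rewrite pE.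
Qed.

Lemma is_derive_cosM u x : is_derive x 1 (fun y => cos (y * u)) (- (u * sin (x * u))).
Proof.
have h : is_derive x 1 (fun y => y * u) u.
  under eq_fun do rewrite mulrC.
  by have := is_deriveZ u (is_derive_id x (1 : R)); rewrite /GRing.scale/= mulr1.
rewrite mulrC -mulNr.
exact: (@is_derive1_comp _ _ (fun y => y * u) _ _ _ (is_derive_cos (x * u)) h).
Qed.

Lemma is_derive_sinM u x : is_derive x 1 (fun y => sin (y * u)) (u * cos (x * u)).
Proof.
have h : is_derive x 1 (fun y => y * u) u.
  under eq_fun do rewrite mulrC.
  by have := is_deriveZ u (is_derive_id x (1 : R)); rewrite /GRing.scale/= mulr1.
rewrite mulrC.
exact: (@is_derive1_comp _ _ (fun y => y * u) _ _ _ (is_derive_sin (x * u)) h).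
Qed.

Variable c : R.
Hypothesis c0 : 0 < c.

(** Differentiating [F] twice under the integral would leave u^2 cos(au) / (c^2 + u^2), which is not
    absolutely integrable. The extra u^-2 in [k] cures this: [H] has derivative [H1], which has
    derivative [F], and [H] is tied back to [F] by [HF]. *)
Let k u := (u ^+ 2 * (c ^+ 2 + u ^+ 2))^-1.
Let H a := \int[mu]_u ((1 - cos (a * u)) * k u).
Let H1 a := \int[mu]_u (u * sin (a * u) * k u).
Let F a := \int[mu]_u (cos (a * u) / (c ^+ 2 + u ^+ 2)).

Let k_ge0 u : 0 <= k u.
Proof. by rewrite invr_ge0 mulr_ge0 ?sqr_ge0// ltW// add_sqr_gt0. Qed.

(** An equality off the origin; at 0 the left side is 0, hence the inequality. *)
Let sqr_k u : u ^+ 2 * k u <= (c ^+ 2 + u ^+ 2)^-1.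
Proof.
rewrite /k invfM mulrA; have [->|u0] := eqVneq u 0.
  by rewrite expr0n/= invr0 !mul0r invr_ge0 addr0 sqr_ge0.
by rewrite mulfV ?expf_neq0// mul1r.
Qed.

Let continuous_k u : u != 0 -> {for u, continuous k}.
Proof.
move=> u0; apply: cvgV; first by rewrite mulf_neq0 ?expf_neq0// gt_eqF// add_sqr_gt0.
apply: cvgM; first exact: exprn_continuous.
by apply: cvgD; [exact: cvg_cst|exact: exprn_continuous].
Qed.

Let continuous_sinM a : continuous (fun u => sin (a * u)).
Proof.
move=> u; apply: continuous_comp; last exact: continuous_sin.
by apply: cvgM; [exact: cvg_cst|exact: cvg_id].
Qed.

Let mH a : measurable_fun setT (fun u => (1 - cos (a * u)) * k u).
Proof.
apply: measurable_fun_punctured => u u0; apply: cvgM; last exact: continuous_k.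
by apply: cvgB; [exact: cvg_cst|exact: continuous_cosM].
Qed.

Let mH1 a : measurable_fun setT (fun u => u * sin (a * u) * k u).
Proof.
apply: measurable_fun_punctured => u u0; apply: cvgM; last exact: continuous_k.
by apply: cvgM; [exact: cvg_id|exact: continuous_sinM].
Qed.

Let mH2 a : measurable_fun setT (fun u => u ^+ 2 * cos (a * u) * k u).
Proof.
apply: measurable_fun_punctured => u u0; apply: cvgM; last exact: continuous_k.
by apply: cvgM; [exact: exprn_continuous|exact: continuous_cosM].
Qed.

Lemma continuous_cos_kernel a : continuous (fun u => cos (a * u) / (c ^+ 2 + u ^+ 2)).
Proof.
by move=> u; apply: cvgM; [exact: continuous_cosM|exact: continuous_add_sqrV].
Qed.

Let mF a : measurable_fun setT (fun u => cos (a * u) / (c ^+ 2 + u ^+ 2)).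
Proof. exact: continuous_measurable_fun (@continuous_cos_kernel a). Qed.

(** The bound 1 - cos x <= x^2 / 2 supplies the u^2 that cancels the singularity of [k]; in [bH1]
    the sine supplies the missing factor u. *)
Let bH a u : `|(1 - cos (a * u)) * k u| <= (a ^+ 2 / 2) / (c ^+ 2 + u ^+ 2).
Proof.
rewrite ger0_norm ?mulr_ge0 ?onem_cos_ge0//.
apply: (@le_trans _ _ ((a * u) ^+ 2 / 2 * k u)).
  by apply: ler_wpM2r => //; exact: onem_cos_le.
rewrite (_ : _ * k u = (a ^+ 2 / 2) * (u ^+ 2 * k u)); last by rewrite exprMn; ring.
by apply: ler_wpM2l => //; rewrite divr_ge0 ?sqr_ge0.
Qed.

Let bH1 a u : `|u * sin (a * u) * k u| <= `|a| / (c ^+ 2 + u ^+ 2).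
Proof.
rewrite !normrM (ger0_norm (k_ge0 u)).
apply: (@le_trans _ _ (`|u| * (`|a| * `|u|) * k u)).
  apply: ler_wpM2r => //; apply: ler_wpM2l => //; rewrite -normrM.
  exact: le_norm_sin.
rewrite (_ : _ * k u = `|a| * (u ^+ 2 * k u)); last first.
  by rewrite -[in RHS](real_normK (num_real u)); ring.
exact: ler_wpM2l.
Qed.

Let bH2 a u : `|u ^+ 2 * cos (a * u) * k u| <= 1 / (c ^+ 2 + u ^+ 2).
Proof.
have uk0 : 0 <= u ^+ 2 * k u by rewrite mulr_ge0 ?sqr_ge0.
rewrite mulrAC normrM (ger0_norm uk0) mul1r; apply: le_trans (sqr_k u).
exact: ler_piMr uk0 (cos_max _).
Qed.

Let bF a u : `|cos (a * u) / (c ^+ 2 + u ^+ 2)| <= 1 / (c ^+ 2 + u ^+ 2).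
Proof.
rewrite normrM (ger0_norm (x := (_)^-1)) ?invr_ge0 ?(ltW (add_sqr_gt0 _ _))//.
by apply: ler_wpM2r; [rewrite invr_ge0 ltW// add_sqr_gt0|exact: cos_max].
Qed.

Lemma integrable_cos_kernel a :
  mu.-integrable setT (EFin \o (fun u => cos (a * u) / (c ^+ 2 + u ^+ 2))).
Proof. exact: integrable_dominated c0 (mF a) (bF a). Qed.

Let dH a : is_derive a 1 H (H1 a).
Proof.
apply: (@is_derive_under_integral (fun a u => (1 - cos (a * u)) * k u)
  (fun a u => u * sin (a * u) * k u) a c (`|a| + 1)) => //.
- by move=> x; exact: integrable_dominated c0 (mH x) (bH x).
- move=> x u; have h1 := is_deriveB (is_derive_cst (1 : R) x 1) (is_derive_cosM u x).
  have h2 := is_deriveZ (k u) h1.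
  under eq_fun do rewrite mulrC.
  by move: h2; rewrite sub0r opprK [_ *: _]mulrC.
- move=> x u; rewrite in_itv/= => /andP[ax xa]; apply: (le_trans (bH1 x u)).
  apply: ler_wpM2r; first by rewrite invr_ge0 ltW// add_sqr_gt0.
  rewrite -[x](subrK a) (le_trans (ler_normD _ _))// addrC lerD2l.
  by rewrite ltW// ltr_distl ax.
Qed.

Let dH1 a : is_derive a 1 H1 (F a).
Proof.
rewrite (_ : F a = \int[mu]_u (u ^+ 2 * cos (a * u) * k u)); last first.
  apply: Rintegral_punctured => // u u0.
  by rewrite /k; field; rewrite u0 (gt_eqF (add_sqr_gt0 u c0)).
apply: (@is_derive_under_integral (fun a u => u * sin (a * u) * k u)
  (fun a u => u ^+ 2 * cos (a * u) * k u) a c 1) => //.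
- by move=> x; exact: integrable_dominated c0 (mH1 x) (bH1 x).
- move=> x u; have h2 := is_deriveZ (u * k u) (is_derive_sinM u x).
  under eq_fun do rewrite mulrAC.
  by move: h2; rewrite (_ : _ *: _ = u ^+ 2 * cos (x * u) * k u) // /GRing.scale/=; ring.
Qed.

Let F0 : F 0 = pi / c.
Proof.
rewrite /F; under eq_Rintegral do rewrite mul0r cos0 mul1r.
by rewrite /Rintegral integral_add_sqrV.
Qed.

Let intV (M : R) : \int[mu]_u (M / (c ^+ 2 + u ^+ 2)) = M * (pi / c).
Proof.
rewrite RintegralZl//; last exact: integrable_add_sqrV.
by rewrite /Rintegral integral_add_sqrV.
Qed.

Let integrableV (M : R) : mu.-integrable setT (EFin \o (fun u => M / (c ^+ 2 + u ^+ 2))).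
Proof.
apply: (@integrable_dominated _ c `|M|) => //.
  apply: measurable_funM => //; apply: continuous_measurable_fun.
  exact: continuous_add_sqrV.
by move=> u; rewrite normrM (ger0_norm (x := _^-1))// invr_ge0 ltW// add_sqr_gt0.
Qed.

Let le_int (f : R -> R) (M : R) : measurable_fun setT f ->
  (forall u, `|f u| <= M / (c ^+ 2 + u ^+ 2)) -> `|\int[mu]_u f u| <= M * (pi / c).
Proof.
move=> mf fM; have iF := integrable_dominated c0 mf fM.
apply: (le_trans (le_normr_Rintegral _ _)) => //.
rewrite -intV; apply: le_Rintegral => //; exact: integrable_norm.
Qed.

(* Off the origin 1 / (u^2 (c^2 + u^2)) = c^-2 (u^-2 - 1 / (c^2 + u^2)). *)
Let HF : exists K : R, forall a, 0 <= a -> c ^+ 2 * H a = a * K - pi / c + F a.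
Proof.
(* Writing pi / c back as [F 0] turns the whole right side into one integral. *)
have [K HK] := @integral_fejer R; exists K => a a0; rewrite -HK// -F0.
have iB : mu.-integrable setT
    (EFin \o (fun u => (1 - cos (a * u)) / u ^+ 2 - 1 / (c ^+ 2 + u ^+ 2))).
  rewrite /comp; under eq_fun do rewrite EFinB.
  by apply: integrableB => //; [exact: integrable_fejer|exact: integrableV].
rewrite /H -RintegralZl//; last exact: integrable_dominated c0 (mH a) (bH a).
rewrite /F; under [X in _ - X + _]eq_Rintegral do rewrite mul0r cos0.
rewrite -RintegralB//; [|exact: integrable_fejer|exact: integrableV].
rewrite -RintegralD//; last exact: integrable_cos_kernel.
apply: Rintegral_punctured.
- by apply: measurable_funM => //; exact: mH.
- apply: measurable_funD; last exact: mF.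
  apply: measurable_funB; first exact: measurable_fejer.
  apply: measurable_funM => //; apply: continuous_measurable_fun.
  exact: continuous_add_sqrV.
- by move=> u u0; rewrite /k; field; rewrite u0 (gt_eqF (add_sqr_gt0 u c0)).
Qed.

Lemma is_derive_expM b x : is_derive x 1 (fun y => expR (b * y)) (b * expR (b * x)).
Proof.
have h : is_derive x 1 (fun y => b * y) b.
  by have := is_deriveZ b (is_derive_id x (1 : R)); rewrite /GRing.scale/= mulr1.
rewrite mulrC.
exact: (@is_derive1_comp _ _ (fun y => b * y) _ _ _ (is_derive_expR (b * x)) h).
Qed.

Let is_derive_linear b x : is_derive x 1 (fun y => b * y) b.
Proof. by have := is_deriveZ b (is_derive_id x (1 : R)); rewrite /GRing.scale/= mulr1. Qed.

(** By the mean value theorem. The derivative is asked to vanish on the half line only, because [HF]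
    holds only there. *)
Let const_of_derive (f df : R -> R) a : 0 <= a -> (forall x, is_derive x 1 f (df x)) ->
  (forall x, 0 <= x -> df x = 0) -> f a = f 0.
Proof.
move=> a0 fdf df0; apply/eqP; rewrite -subr_eq0.
have [|x] := @MVT_segment R f df 0 a a0 (fun y _ => fdf y).
  by apply: continuous_subspaceT => x; exact: is_derive_continuous (fdf x).
by rewrite in_itv/= => /andP[x0 _] ->; rewrite df0// mul0r.
Qed.

(** Already the quadratic minorant 1 + x^2 / 2 of the exponential outgrows A + B a. *)
Let exp_not_linear (v A B : R) : 0 <= A -> 0 <= B ->
  (forall a, 0 <= a -> `|v| * expR (c * a) <= A + B * a) -> v = 0.
Proof.
move=> A0 B0 vAB; apply/eqP; rewrite -normr_eq0; apply/negPn/negP => v0.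
have {}v0 : 0 < `|v| by rewrite lt0r v0 /=.
pose D := `|v| * c ^+ 2; have D0 : 0 < D by rewrite mulr_gt0// exprn_gt0.
(* Chosen so that D a^2 / 2 = (A + B) a + D a / 2, which exceeds A + B a because a >= 1. *)
pose a := (A + B) * 2 / D + 1.
have a1 : 1 <= a by rewrite lerDr divr_ge0 ?mulr_ge0 ?addr_ge0// ltW.
have a0 : 0 <= a by rewrite (le_trans ler01).
have Da : D * a = (A + B) * 2 + D by rewrite /a; field; rewrite (gt_eqF D0).
have h1 := vAB _ a0.
have h2 : `|v| * (1 + (c * a) ^+ 2 / 2) <= `|v| * expR (c * a).
  apply: ler_wpM2l => //; apply: (expR_ge1Dxn 1).
  by rewrite mulr_ge0// ltW.
have h3 : `|v| * (1 + (c * a) ^+ 2 / 2) = `|v| + D * a * a / 2 by rewrite /D; field.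
rewrite h3 Da in h2.
have h4 : 0 <= A * (a - 1) by rewrite mulr_ge0// subr_ge0.
have h5 : 0 < D * a by rewrite mulr_gt0// (lt_le_trans ltr01).
have := le_trans h2 h1; lra.
Qed.

(* F extends to a solution y of y'' = c^2 y; v = y' + c y is a multiple of
   exp (c x) and grows at most linearly, hence vanishes. *)
Let cos_transform_ge0 a : 0 <= a -> F a = pi / c * expR (- c * a).
Proof.
have [K HK] := HF.
pose y x := c ^+ 2 * H x - K * x + pi / c.
pose y1 x := c ^+ 2 * H1 x - K.
have yF x : 0 <= x -> y x = F x by move=> x0; rewrite /y HK//; ring.
have dy x : is_derive x 1 y (y1 x).
  have := is_deriveD (is_deriveB (is_deriveZ (c ^+ 2) (dH x)) (is_derive_linear K x))
    (is_derive_cst (pi / c : R) x 1).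
  by rewrite addr0.
have dy1 x : is_derive x 1 y1 (c ^+ 2 * F x).
  have := is_deriveB (is_deriveZ (c ^+ 2) (dH1 x)) (is_derive_cst K x 1).
  by rewrite subr0.
pose v x := y1 x + c * y x.
have dv x : is_derive x 1 v (c ^+ 2 * F x + c * y1 x).
  exact: is_deriveD (dy1 x) (is_deriveZ c (dy x)).
(* On the half line v' = c^2 y + c y' = c v, so v(x) exp(-c x) is constant. *)
have ve x : 0 <= x -> v x = v 0 * expR (c * x).
  move=> x0; have := @const_of_derive (fun z => v z * expR (- c * z))
    (fun z => v z * (- c * expR (- c * z)) + expR (- c * z) * (c ^+ 2 * F z + c * y1 z)) x x0.
  move=> /(_ (fun z => is_deriveM (dv z) (is_derive_expM (- c) z))).
  move=> h; have {}h : v x * expR (- c * x) = v 0 * expR (- c * 0).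
    by apply: h => z z0; rewrite -(yF z z0) /v; ring.
  have e1 : expR (- c * x) * expR (c * x) = 1 by rewrite -expRD mulNr addNr expR0.
  by rewrite -[LHS]mulr1 -e1 mulrA h mulr0 expR0 mulr1.
have v0 : v 0 = 0.
  (* The constants come from |H1(x)| <= x pi / c and |F(x)| <= pi / c. *)
  apply: (@exp_not_linear _ (`|K| + c * (pi / c)) (c ^+ 2 * (pi / c))).
  - by rewrite addr_ge0// mulr_ge0 ?divr_ge0 ?pi_ge0// ltW.
  - by rewrite mulr_ge0 ?divr_ge0 ?pi_ge0 ?sqr_ge0// ltW.
  move=> x x0; rewrite -[expR _]ger0_norm ?expR_ge0// -normrM -ve// /v yF//.
  have hH := le_int (mH1 x) (bH1 x); have hF := le_int (mF x) (bF x).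
  rewrite -/(H1 x) in hH; rewrite -/(F x) in hF.
  rewrite (le_trans (ler_normD _ _))// [leRHS]addrAC lerD//; last first.
    by rewrite normrM (gtr0_norm c0) ler_pM2l// -[leRHS]mul1r.
  rewrite (le_trans (ler_normB _ _))// [leLHS]addrC lerD2l.
  rewrite normrM ger0_norm ?sqr_ge0// -mulrA ler_wpM2l ?sqr_ge0//.
  by rewrite (le_trans hH)// (ger0_norm x0) mulrC.
(* Since v = 0 means y' = -c y, the product y(x) exp(c x) keeps its value pi / c at the origin. *)
move=> a0; have := @const_of_derive (fun z => y z * expR (c * z))
    (fun z => y z * (c * expR (c * z)) + expR (c * z) * y1 z) a a0.
move=> /(_ (fun z => is_deriveM (dy z) (is_derive_expM c z))).
move=> h; have {}h : y a * expR (c * a) = y 0 * expR (c * 0).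
  apply: h => z z0; have := ve z z0; rewrite v0 mul0r /v => hz.
  by rewrite (_ : y1 z = - (c * y z)); [ring|apply/eqP; rewrite -addr_eq0 hz].
have e1 : expR (c * a) * expR (- c * a) = 1 by rewrite -expRD mulNr addrN expR0.
rewrite -yF// -[LHS]mulr1 -e1 mulrA h mulr0 expR0 mulr1; congr (_ * _).
by rewrite yF// F0.
Qed.

Lemma cos_transform a :
  \int[mu]_u (cos (a * u) / (c ^+ 2 + u ^+ 2)) = pi / c * expR (- c * `|a|).
Proof.
rewrite -cos_transform_ge0//; apply: eq_Rintegral => u _.
by congr (_ / _); case: (ger0P a) => // _; rewrite mulNr cosN.
Qed.

Lemma integrable_sin_kernel a :
  mu.-integrable setT (EFin \o (fun u => sin (a * u) / (c ^+ 2 + u ^+ 2))).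
Proof.
apply: (@integrable_dominated _ c 1) => //.
  apply: continuous_measurable_fun => u.
  by apply: cvgM; [exact: continuous_sinM|exact: continuous_add_sqrV].
move=> u; rewrite normrM (ger0_norm (x := (_)^-1)) ?invr_ge0 ?(ltW (add_sqr_gt0 _ _))//.
by apply: ler_wpM2r; [rewrite invr_ge0 ltW// add_sqr_gt0|exact: sin_max].
Qed.

(* The sine kernel is odd; adding the constant kernel makes it nonnegative,
   so that the reflection of the half line applies. *)
Lemma sin_transform a : \int[mu]_u (sin (a * u) / (c ^+ 2 + u ^+ 2)) = 0.
Proof.
pose g b u := (1 + sin (b * u)) / (c ^+ 2 + u ^+ 2).
have cg b : continuous (g b).
  move=> u; apply: cvgM; last exact: continuous_add_sqrV.
  by apply: cvgD; [exact: cvg_cst|exact: continuous_sinM].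
have g0 b u : 0 <= g b u.
  rewrite /g; apply: divr_ge0; last by rewrite ltW// add_sqr_gt0.
  by have := sin_geN1 (b * u); lra.
have split (f : R -> R) : continuous f -> (forall u, 0 <= f u) ->
  (\int[mu]_u (f u)%:E = \int[mu]_(u in `[0%R, +oo[) (f (- u))%:E + \int[mu]_(u in `[0%R, +oo[) (f u)%:E)%E.
  move=> cf f0; rewrite -(setUv `]-oo, 0%R]%classic) ge0_integral_setU//=.
  - congr (_ + _)%E.
      rewrite -[in LHS]oppr0 ge0_integration_by_substitutionNy//.
      exact: continuous_subspaceT.
    rewrite -integral_itv_obnd_cbnd; first by rewrite setCitvl.
    by apply/measurable_EFinP/measurable_funTS; exact: continuous_measurable_fun.
  - exact: measurableC.
  - rewrite setUv; apply/measurable_EFinP; exact: continuous_measurable_fun.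
  - by move=> u _; rewrite lee_fin.
  - exact/disj_setPCl.
(* Replacing [a] by [- a] exchanges the contributions of the two half lines. Hence the sine integral
   equals its own opposite. *)
have E : (\int[mu]_u (g a u)%:E = \int[mu]_u (g (- a) u)%:E)%E.
  rewrite (split _ (cg a))// (split _ (cg (- a)))// addeC; congr (_ + _)%E.
  - by apply: eq_integral => u _; rewrite /g mulrNN sqrrN.
  - by apply: eq_integral => u _; rewrite /g mulrN -mulNr sqrrN.
have gE b : \int[mu]_u g b u = pi / c + \int[mu]_u (sin (b * u) / (c ^+ 2 + u ^+ 2)).
  rewrite -[pi / c]mul1r -intV -RintegralD//; [|exact: integrable_sin_kernel].
  by apply: eq_Rintegral => u _; rewrite /g mulrDl.
have {}E : \int[mu]_u g a u = \int[mu]_u g (- a) u by rewrite /Rintegral E.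
move: E; rewrite !gE => /addrI.
rewrite (_ : \int[mu]_u (sin (- a * u) / (c ^+ 2 + u ^+ 2)) =
    - \int[mu]_u (sin (a * u) / (c ^+ 2 + u ^+ 2))); last first.
  rewrite -[RHS]mulN1r -RintegralZl//; last exact: integrable_sin_kernel.
  by apply: eq_Rintegral => u _; rewrite mulN1r mulNr sinN mulNr.
by move=> h; lra.
Qed.

End cos_transform.

(** * The energy in terms of partial sums *)

Section complex_exponential.
Context {R : realType}.
Implicit Types (z w : R[i]).
Local Notation Re := complex.Re.
Local Notation Im := complex.Im.

Lemma ReD z w : Re (z + w) = Re z + Re w. Proof. by case: z; case: w. Qed.
Lemma ImD z w : Im (z + w) = Im z + Im w. Proof. by case: z; case: w. Qed.
Lemma ReM z w : Re (z * w) = Re z * Re w - Im z * Im w.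
Proof. by case: z; case: w. Qed.
Lemma ImM z w : Im (z * w) = Re z * Im w + Im z * Re w.
Proof. by case: z => a b; case: w => a' b' /=. Qed.

Lemma Re_sum (I : Type) (r : seq I) (P : pred I) (F : I -> R[i]) :
  Re (\sum_(i <- r | P i) F i) = \sum_(i <- r | P i) Re (F i).
Proof. by elim/big_rec2: _ => // i x y _ <-; rewrite ReD. Qed.

Lemma Im_sum (I : Type) (r : seq I) (P : pred I) (F : I -> R[i]) :
  Im (\sum_(i <- r | P i) F i) = \sum_(i <- r | P i) Im (F i).
Proof. by elim/big_rec2: _ => // i x y _ <-; rewrite ImD. Qed.

Lemma sqr_normcE z : Normc.normc z ^+ 2 = Re z ^+ 2 + Im z ^+ 2.
Proof. by case: z => a b /=; rewrite sqr_sqrtr// addr_ge0 ?sqr_ge0. Qed.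

Lemma normc_ge0 z : 0 <= Normc.normc z.
Proof. by case: z => a b; exact: sqrtr_ge0. Qed.

Lemma cexpD z w : cexp (z + w) = cexp z * cexp w.
Proof.
case: z w => a b [a' b']; apply/eqP; rewrite eq_complex /= expRD cosD sinD.
by apply/andP; split; apply/eqP; ring.
Qed.

Lemma cexp0 : cexp (0 : R[i]) = 1.
Proof. by rewrite /cexp /= expR0 cos0 sin0 mul1r mulr0. Qed.

Lemma normc_cexp z : Normc.normc (cexp z) = expR (Re z).
Proof.
apply/eqP; rewrite -(@eqrXn2 _ 2)// ?normc_ge0 ?expR_ge0// sqr_normcE /=.
by rewrite !exprMn -mulrDr cos2Dsin2 mulr1.
Qed.

Lemma conjc_cexp z : (cexp z)^*%C = cexp (z^*%C).
Proof. by case: z => a b; rewrite /cexp /= cosN sinN mulrN. Qed.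

End complex_exponential.

(** Since [E] is cut off to 0 at [n], the last difference carries the boundary term of Abel
    summation. This serves both [weight] and [node_diff]. *)
Lemma sum_tail_telescope (V : zmodType) (E : nat -> V) n i : (i < n)%N ->
  \sum_(j < n | (i <= j)%N) (E j - (if (j.+1 < n)%N then E j.+1 else 0)) = E i.
Proof.
move=> ltin; pose u j := if (j < n)%N then E j else 0.
rewrite (eq_bigr (fun j : 'I_n => u j - u j.+1)); last first.
  by move=> j _; rewrite /u ltn_ord.
rewrite -(big_geq_mkord _ _ xpredT (fun j => u j - u j.+1)).
under eq_bigr do rewrite -opprB.
by rewrite sumrN telescope_sumr ?(ltnW ltin)// opprB /u ltin ltnn subr0.
Qed.

(** * Diagonalization of the energy *)

Section energy.
Context {R : realType}.
Let mu : {measure set _ -> \bar R} := @lebesgue_measure R.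
Local Notation Re := complex.Re.
Local Notation Im := complex.Im.

(* Indices are shifted by one: [k < n] stands for the integer [k + 1 <= n]. *)
Definition log_node (k : nat) : R := ln k.+1%:R.

Lemma log_node0 : log_node 0 = 0. Proof. exact: ln1. Qed.

Lemma le_log_node : {mono log_node : k l / (k <= l)%N >-> k <= l}.
Proof. by move=> k l; rewrite ler_ln ?posrE ?ltr0n// ler_nat. Qed.

Lemma dirichlet_polyE (n : nat) (b : nat -> R[i]) s :
  dirichlet_poly n b s = \sum_(k < n) b k.+1 * cexp (- s * (log_node k)%:C%C).
Proof. by rewrite /dirichlet_poly big_add1 /= big_mkord. Qed.

Definition partial_coef n (b : nat -> R[i]) (j : nat) : R[i] :=
  \sum_(k < n | (k <= j)%N) b k.+1.

(* [weight n c j] is the integral of y^(-2c-1) over [j + 1, j + 2], extended to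
   [n, +oo[ for the last index [j = n - 1]. *)
Definition weight n (c : R) (j : nat) : R :=
  (expR (- (2 * c) * log_node j) -
   (if (j.+1 < n)%N then expR (- (2 * c) * log_node j.+1) else 0)) / (2 * c).

Lemma weight_gt0 n c j : 0 < c -> 0 < weight n c j.
Proof.
move=> c0; rewrite divr_gt0 ?mulr_gt0// subr_gt0; case: ifP => _; last exact: expR_gt0.
rewrite ltr_expR ltr_nM2l ?oppr_lt0 ?mulr_gt0//.
by rewrite ltNge le_log_node ltnn.
Qed.

Lemma sum_weight n c i : (i < n)%N ->
  \sum_(j < n | (i <= j)%N) weight n c j = expR (- (2 * c) * log_node i) / (2 * c).
Proof.
move=> ltin; rewrite -mulr_suml.
by rewrite (sum_tail_telescope (fun j => expR (- (2 * c) * log_node j))).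
Qed.

(** Termwise integration; the sine part integrates to 0, so [Q] leaves no trace. *)
Lemma integral_trig_sum c n (P Q y : 'I_n -> 'I_n -> R) : 0 < c ->
  (\int[mu]_u ((\sum_k \sum_l (P k l * cos (y k l * u) + Q k l * sin (y k l * u)))
     / (c ^+ 2 + u ^+ 2))%:E =
   (\sum_k \sum_l P k l * (pi / c * expR (- c * `|y k l|)))%:E)%E.
Proof.
move=> c0; rewrite -sumEFin.
under [RHS]eq_bigr do rewrite -sumEFin.
have icos k l : mu.-integrable setT
    (EFin \o (fun u => P k l * (cos (y k l * u) / (c ^+ 2 + u ^+ 2)))).
  by rewrite /comp; under eq_fun do rewrite EFinM; apply: integrableZl => //; exact: integrable_cos_kernel.
have isin k l : mu.-integrable setT
    (EFin \o (fun u => Q k l * (sin (y k l * u) / (c ^+ 2 + u ^+ 2)))).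
  by rewrite /comp; under eq_fun do rewrite EFinM; apply: integrableZl => //; exact: integrable_sin_kernel.
pose f k l u := P k l * (cos (y k l * u) / (c ^+ 2 + u ^+ 2)) +
  Q k l * (sin (y k l * u) / (c ^+ 2 + u ^+ 2)).
have intf k l : mu.-integrable setT (EFin \o f k l).
  by rewrite /comp /f; under eq_fun do rewrite EFinD; exact: (integrableD measurableT (icos k l) (isin k l)).
have fE k l : (\int[mu]_u (f k l u)%:E = (P k l * (pi / c * expR (- c * `|y k l|)))%:E)%E.
  rewrite -[LHS]fineK; last exact: (integrable_fin_num measurableT (intf k l)).
  congr EFin; rewrite -/(Rintegral mu setT (f k l)) RintegralD// !RintegralZl//;
    [|exact: integrable_sin_kernel|exact: integrable_cos_kernel].
  by rewrite cos_transform// sin_transform// mulr0 addr0.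
transitivity (\int[mu]_u (\sum_k \sum_l (f k l u)%:E))%E.
  apply: eq_integral => u _; rewrite mulr_suml -sumEFin; apply: eq_bigr => k _.
  rewrite mulr_suml -sumEFin; apply: eq_bigr => l _.
  by rewrite /f mulrDl !mulrA.
rewrite integral_sum//=; last by move=> k; apply: integrable_sum => // l _; exact: intf.
apply: eq_bigr => k _; rewrite integral_sum//; last by move=> l; exact: intf.
by apply: eq_bigr => l _; rewrite fE.
Qed.

(** Expansion of B times its conjugate. The coefficients of cosine and sine are the real and
    imaginary parts of b_k conj(b_l), scaled by (kl)^(-c). *)
Lemma normc_dirichlet_poly c n b u :
  Normc.normc (dirichlet_poly n b (c +i* u)%C / (c +i* u)%C) ^+ 2 =
  (\sum_(k < n) \sum_(l < n)
    (expR (- c * log_node k) * expR (- c * log_node l) *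
       (Re (b k.+1) * Re (b l.+1) + Im (b k.+1) * Im (b l.+1)) *
       cos ((log_node k - log_node l) * u) +
     expR (- c * log_node k) * expR (- c * log_node l) *
       (Im (b k.+1) * Re (b l.+1) - Re (b k.+1) * Im (b l.+1)) *
       sin ((log_node k - log_node l) * u))) / (c ^+ 2 + u ^+ 2).
Proof.
rewrite Normc.normcM Normc.normcV exprMn exprVn [X in _ / X]sqr_normcE /=.
congr (_ / _); rewrite sqr_normcE dirichlet_polyE Re_sum Im_sum !expr2 !big_distrlr /=.
rewrite -big_split /=; apply: eq_bigr => k _; rewrite -big_split /=; apply: eq_bigr => l _.
rewrite !(ReM, ImM) /= !mulr0 !subr0 !add0r !mulNr !cosN !sinN.
rewrite [(log_node k - log_node l) * u]mulrBl cosB sinB ![u * _]mulrC; ring.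
Qed.

(** The inner product of two monomials is the sum of the weights with index at least [maxn k l].
    After exchanging the sums, a given index j collects all b_k conj(b_l) with k, l <= j, which add
    up to the squared modulus of a partial sum. *)
Lemma energy_dirichlet_poly (p : R) n b : 0 < p ->
  energy p (dirichlet_poly n b) =
  (\sum_(j < n) weight n p^-1 j * Normc.normc (partial_coef n b j) ^+ 2)%:E.
Proof.
move=> p0; set c := p^-1; have c0 : 0 < c by rewrite invr_gt0.
rewrite /energy /line_integral.
under eq_integral do rewrite normc_dirichlet_poly.
rewrite integral_trig_sum// -EFinM; congr EFin.
transitivity (\sum_(j < n) weight n c j * \sum_(k < n | (k <= j)%N) \sum_(l < n | (l <= j)%N)
   (Re (b k.+1) * Re (b l.+1) + Im (b k.+1) * Im (b l.+1))); last first.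
  apply: eq_bigr => j _; congr (_ * _).
  rewrite sqr_normcE Re_sum Im_sum !expr2 !big_distrlr /= -big_split /=.
  by apply: eq_bigr => k _; rewrite -big_split.
under [RHS]eq_bigr do rewrite big_mkcond mulr_sumr /=.
rewrite -/c [RHS]exchange_big mulr_sumr /=; apply: eq_bigr => k _.
transitivity (\sum_(l < n) (Re (b k.+1) * Re (b l.+1) + Im (b k.+1) * Im (b l.+1)) *
    \sum_(j < n | (maxn k l <= j)%N) weight n c j).
  rewrite mulr_sumr; apply: eq_bigr => l _.
  rewrite sum_weight; last by rewrite gtn_max !ltn_ord.
  set P := Re _ * _ + _.
  (* From x + y + |x - y| = 2 max(x, y) in the exponent. *)
  have -> : expR (- (2 * c) * log_node (maxn k l)) =
     expR (- c * log_node k) * expR (- c * log_node l) * expR (- c * `|log_node k - log_node l|).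
    rewrite -!expRD; congr expR.
    by case: (leqP k l) => [kl|/ltnW lk];
      [rewrite ler0_norm ?subr_le0 ?le_log_node//|rewrite ger0_norm ?subr_ge0 ?le_log_node//]; ring.
  have := gt_eqF (pi_gt0 R); move: (pi : R) => q q0.
  by field; rewrite q0 (gt_eqF c0).
under [LHS]eq_bigr do rewrite mulr_sumr big_mkcond /=.
rewrite [LHS]exchange_big /=; apply: eq_bigr => j _.
have [kj|jk] := leqP k j; last first.
  by rewrite mulr0 big1// => l _; rewrite geq_max leqNgt jk.
rewrite mulr_sumr [RHS]big_mkcond; apply: eq_bigr => l _.
by rewrite geq_max kj /=; case: ifP => // _; rewrite mulrC.
Qed.

End energy.

(** * Complex moduli and the interpolation conditions in terms of partial sums *)

Section interpolation.
Context {R : realType}.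
Local Notation Re := complex.Re.
Local Notation Im := complex.Im.
Local Notation normc := Normc.normc.

Lemma normc_triangle (x y : R[i]) : normc (x + y) <= normc x + normc y.
Proof. exact: le_normcD. Qed.

Lemma normc_opp (x : R[i]) : normc (- x) = normc x.
Proof. exact: normcN. Qed.

Lemma normc_sum (I : Type) (r : seq I) (P : pred I) (F : I -> R[i]) :
  normc (\sum_(i <- r | P i) F i) <= \sum_(i <- r | P i) normc (F i).
Proof.
elim/big_rec2: _ => [|i y z _ h]; first by rewrite Normc.normc0.
by rewrite (le_trans (normc_triangle _ _))// lerD2l.
Qed.

Lemma conjcM (x y : R[i]) : conjc (x * y) = conjc x * conjc y.
Proof. exact: rmorphM. Qed.

Lemma conjc_sum (I : Type) (r : seq I) (P : pred I) (F : I -> R[i]) :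
  conjc (\sum_(i <- r | P i) F i) = \sum_(i <- r | P i) conjc (F i).
Proof. exact: rmorph_sum. Qed.

Lemma normc_real (x : R) : normc x%:C%C = `|x|.
Proof. by rewrite /= expr0n addr0 sqrtr_sqr. Qed.

Lemma normc_le (z : R[i]) : normc z <= `|Re z| + `|Im z|.
Proof.
rewrite -(@ler_pXn2r _ 2) ?nnegrE ?normc_ge0 ?addr_ge0//.
rewrite sqr_normcE -[in leLHS](real_normK (num_real (Re z))).
rewrite -[in leLHS](real_normK (num_real (Im z))) sqrrD lerD2r lerDl.
by rewrite mulrn_wge0// mulr_ge0.
Qed.

(** The coefficient of a partial sum in B(s), cut off at the last index in the same way as
    [weight]. *)
Definition node_diff n (s : R[i]) (j : nat) : R[i] :=
  cexp (- s * (log_node j)%:C%C) -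
  (if (j.+1 < n)%N then cexp (- s * (log_node j.+1)%:C%C) else 0).

(** Abel summation: each monomial is a tail sum of [node_diff]. *)
Lemma dirichlet_poly_partial n (b : nat -> R[i]) s :
  dirichlet_poly n b s = \sum_(j < n) partial_coef n b j * node_diff n s j.
Proof.
rewrite dirichlet_polyE.
under [RHS]eq_bigr do rewrite /partial_coef mulr_suml big_mkcond /=.
rewrite [RHS]exchange_big; apply: eq_bigr => k _ /=.
rewrite -(sum_tail_telescope (fun j => cexp (- s * (log_node j)%:C%C)) (ltn_ord k)).
by rewrite mulr_sumr big_mkcond.
Qed.

(** Successive differences of [S] serve as coefficients, so a minimization over Dirichlet
    polynomials is one over arbitrary vectors of partial sums. *)
Lemma partial_coef_surj n (S : nat -> R[i]) :
  exists b, forall j, (j < n)%N -> partial_coef n b j = S j.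
Proof.
pose D k := S k - (if k is k'.+1 then S k' else 0).
(* The predecessor undoes the index shift [b k.+1] in [partial_coef]. *)
exists (fun k => D k.-1) => j ltjn; rewrite /partial_coef /=.
transitivity (\sum_(k < j.+1) D k); first by rewrite (big_ord_widen _ D ltjn).
elim: j {ltjn} => [|j IH]; first by rewrite big_ord1 /D subr0.
by rewrite big_ord_recr /= IH /D addrC subrK.
Qed.

(** * Linear algebra *)

Section minimal_norm.
Variables (m n : nat) (w : nat -> R) (a : 'I_m -> nat -> R[i]) (lam : 'I_m -> R[i]).
Hypothesis w0 : forall j, 0 < w j.
Hypothesis lamG : forall i,
  \sum_l lam l * (\sum_(j < n) a i j * (a l j)^*%C / (w j)%:C%C) = 1.

(** In the inner product weighted by [w], the shortest solution lies in the span of the constraint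
    vectors conj(a_l) / w. The [lam] are the Lagrange multipliers. *)
Definition minimizer j : R[i] := \sum_l lam l * (a l j)^*%C / (w j)%:C%C.

Lemma minimizer_feasible i : \sum_(j < n) minimizer j * a i j = 1.
Proof.
rewrite -(lamG i); under eq_bigr do rewrite mulr_suml.
rewrite exchange_big; apply: eq_bigr => l _ /=; rewrite mulr_sumr.
by apply: eq_bigr => j _; ring.
Qed.

(** The difference of a feasible vector and the minimizer is orthogonal to the minimizer. The
    identity yields the minimum and its uniqueness at once. *)
Lemma minimizer_pythagoras (S : nat -> R[i]) :
  (forall i, \sum_(j < n) S j * a i j = 1) ->
  \sum_(j < n) w j * normc (S j) ^+ 2 =
  Re (\sum_l lam l) + \sum_(j < n) w j * normc (S j - minimizer j) ^+ 2.
Proof.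
set T := minimizer.
(* The inner product of a feasible vector with [T] sees only the constraints; it is used for [S] and
   for [T] itself. *)
have key (U : nat -> R[i]) : (forall i, \sum_(j < n) U j * a i j = 1) ->
    \sum_(j < n) w j * Re (U j * (T j)^*%C) = Re (\sum_l lam l).
  move=> hU; transitivity (Re (\sum_l (lam l)^*%C * \sum_(j < n) U j * a l j)); last first.
    under eq_bigr do rewrite hU mulr1.
    by rewrite !Re_sum; apply: eq_bigr => l _; case: (lam l).
  rewrite Re_sum; under [RHS]eq_bigr do rewrite mulr_sumr Re_sum.
  rewrite exchange_big; apply: eq_bigr => j _ /=.
  rewrite -Re_sum; transitivity (Re ((w j)%:C%C * (U j * (T j)^*%C))).
    by rewrite ReM /= mul0r subr0.
  congr Re; rewrite /T /minimizer conjc_sum !mulr_sumr; apply: eq_bigr => l _.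
  rewrite !conjcM conjcK conjc_inv conjc_real.
  have : (w j)%:C%C != 0 :> R[i] by rewrite -(rmorph0 (real_complex R)) (inj_eq (@complexI R)) gt_eqF.
  by move=> wj; field.
move=> hS; have h1 := key S hS; have h2 := key T minimizer_feasible.
have E j : w j * normc (S j) ^+ 2 = w j * normc (S j - T j) ^+ 2 +
    (w j * Re (S j * (T j)^*%C) *+ 2 - w j * Re (T j * (T j)^*%C)).
  rewrite !sqr_normcE; case: (S j) => x y; case: (T j) => x' y' /=; ring.
under eq_bigr do rewrite E.
by rewrite big_split sumrB /= sumrMnl h1 h2; ring.
Qed.

End minimal_norm.

(** * Linear systems close to a diagonal one *)

Section near_diagonal.
Variables (m : nat) (G : 'I_m -> 'I_m -> R[i]) (d : 'I_m -> R) (d0 e : R).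
Hypotheses (d00 : 0 < d0) (dd0 : forall i, d0 <= d i) (e0 : 0 <= e)
  (me : m%:R * e <= d0 / 2)
  (Ge : forall i l, normc (G i l - (if i == l then d i else 0)%:C%C) <= e).

Let residual (v r : 'I_m -> R[i]) i : (forall i, \sum_l v l * G i l = r i) ->
  normc ((d i)%:C%C * v i - r i) <= e * \sum_l normc (v l).
Proof.
move=> hv; rewrite -normc_opp opprB -hv.
rewrite (_ : _ - _ = \sum_l v l * (G i l - (if i == l then d i else 0)%:C%C)).
  rewrite (le_trans (normc_sum _ _ _))// mulr_sumr; apply: ler_sum => l _.
  by rewrite Normc.normcM mulrC ler_wpM2r ?normc_ge0.
under [RHS]eq_bigr do rewrite mulrBr.
rewrite sumrB; congr (_ - _); rewrite (bigD1 i)//= eqxx big1 ?addr0 1?mulrC// => l li.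
by rewrite eq_sym (negbTE li) mulr0.
Qed.

(** Summing the residual bounds over i leaves an error m e s, at most half of d0 s, which is
    absorbed on the left. *)
Let norm_bound (v r : 'I_m -> R[i]) : (forall i, \sum_l v l * G i l = r i) ->
  d0 * \sum_l normc (v l) <= 2 * \sum_l normc (r l).
Proof.
move=> hv; set s := \sum_l normc (v l).
have s0 : 0 <= s by apply: sumr_ge0 => l _; exact: normc_ge0.
have h i : d0 * normc (v i) <= normc (r i) + e * s.
  apply: (@le_trans _ _ (normc ((d i)%:C%C * v i))).
    rewrite Normc.normcM normc_real ler_wpM2r ?normc_ge0//.
    by rewrite (le_trans (dd0 i)) ?ler_norm.
  rewrite -[X in normc X](subrK (r i)) (le_trans (normc_triangle _ _))// addrC lerD2l.
  exact: residual.
have : d0 * s <= \sum_l normc (r l) + m%:R * e * s.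
  rewrite /s mulr_sumr; apply: (le_trans (ler_sum _ (fun i _ => h i))).
  by rewrite big_split /= sumr_const card_ord -/s -[(e * s) *+ m]mulr_natl mulrA.
have : m%:R * e * s <= d0 / 2 * s by apply: ler_wpM2r.
lra.
Qed.

(** [norm_bound] with right side 0 gives invertibility. With right side 1 it bounds the solution by
    2 m / d0, and [residual] divided by [d l] gives the error. *)
Lemma solve_near_diagonal : exists v : 'I_m -> R[i],
  (forall i, \sum_l v l * G i l = 1) /\
  (forall l, normc (v l - ((d l)^-1)%:C%C) <= e * (2 * m%:R / d0) / d0).
Proof.
(* The transpose of [G], because the solution is a row vector acting from the left. *)
pose M : 'M[R[i]]_m := \matrix_(l, i) G i l.
have ME (v : 'rV_m) i : (v *m M) 0 i = \sum_l v 0 l * G i l.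
  by rewrite mxE; apply: eq_bigr => l _; rewrite mxE.
have uM : M \in unitmx.
  rewrite -row_free_unit; apply/inj_row_free => v vM0.
  have := @norm_bound (fun l => v 0 l) (fun _ => 0).
  move=> /(_ (fun i => _)); rewrite sumr_const Normc.normc0 mul0rn mulr0.
  move=> h; have {}h : d0 * \sum_l normc (v 0 l) <= 0.
    by apply: h => i; rewrite -ME vM0 mxE.
  have s0 : \sum_l normc (v 0 l) = 0.
    apply/eqP; rewrite eq_le sumr_ge0 ?andbT; last by move=> l _; exact: normc_ge0.
    by rewrite -(ler_pM2l d00) mulr0.
  apply/rowP => l; rewrite mxE; apply: Normc.eq0_normc.
  by have /psumr_eq0P := s0; apply=> // k _; exact: normc_ge0.
pose v : 'rV_m := const_mx 1 *m invmx M.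
have hv i : \sum_l v 0 l * G i l = 1 by rewrite -ME mulmxKV// mxE.
exists (fun l => v 0 l); split=> // l.
have dl : 0 < d l := lt_le_trans d00 (dd0 l).
have hs := norm_bound (r := fun _ => 1) hv.
rewrite sumr_const card_ord Normc.normc1 in hs.
have hr := residual l (r := fun _ => 1) hv.
have dC : (d l)%:C%C != 0 :> R[i] by rewrite -(rmorph0 (real_complex R)) (inj_eq (@complexI R)) gt_eqF.
have -> : v 0 l - ((d l)^-1)%:C%C = ((d l)%:C%C)^-1 * ((d l)%:C%C * v 0 l - 1).
  by rewrite fmorphV mulrBr mulKf// mulr1.
rewrite Normc.normcM Normc.normcV normc_real ger0_norm; last exact: ltW.
rewrite mulrC ler_pM ?normc_ge0 ?invr_ge0 ?(ltW dl)//; last by rewrite lef_pV2.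
apply: (le_trans hr); apply: ler_wpM2l => //.
by rewrite ler_pdivlMr// mulrC.
Qed.

End near_diagonal.
End interpolation.

(** * Asymptotics of the Gram matrix *)

Section logarithmic_averages.
Context {R : realType}.
Local Notation Re := complex.Re.
Local Notation Im := complex.Im.
Local Notation normc := Normc.normc.
Local Notation x_ := (@log_node R).

Definition log_gap (k : nat) : R := x_ k.+1 - x_ k.

Lemma log_gap_gt0 k : 0 < log_gap k.
Proof. by rewrite subr_gt0 ltNge le_log_node ltnn. Qed.

Lemma log_gap_cvg : log_gap k @[k --> \oo] --> (0 : R).
Proof.
apply: (@squeeze_cvgr _ _ _ _ (cst 0) (@harmonic R)).
- apply: nearW => k; rewrite /= ltW ?log_gap_gt0//= /log_gap /log_node.
  rewrite -ln_div ?posrE ?ltr0n// (_ : k.+2%:R / k.+1%:R = 1 + k.+1%:R^-1).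
    by apply: le_ln1Dx; rewrite (@lt_le_trans _ _ 0) ?invr_ge0 ?ltrN10.
  by rewrite -[in LHS]natr1 mulrDl mulfV ?mul1r// pnatr_eq0.
- exact: cvg_cst.
- exact: cvg_harmonic.
Qed.

Lemma log_node_ge0 k : 0 <= x_ k.
Proof. by rewrite -log_node0 le_log_node. Qed.

Lemma log_node_cvgy : x_ k @[k --> \oo] --> +oo.
Proof.
apply/cvgryPge => A; near=> k; rewrite -[A]expRK /log_node.
rewrite ler_ln ?posrE ?expR_gt0 ?ltr0n// -natr1.
apply: (@le_trans _ _ k%:R); last by rewrite lerDl.
by near: k; exact: nbhs_infty_ger.
Unshelve. all: end_near. Qed.

Lemma sum_log_gap N : \sum_(k < N) log_gap k = x_ N.
Proof.
by rewrite -(big_mkord xpredT log_gap) telescope_sumr// log_node0 subr0.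
Qed.

(** A weighted Cesàro mean: the gaps are positive weights of total mass [log_node N], which tends to
    infinity. *)
Lemma log_average (e : nat -> R) : (forall k, 0 <= e k) -> e k @[k --> \oo] --> 0 ->
  (\sum_(k < N) log_gap k * e k) / x_ N @[N --> \oo] --> 0.
Proof.
move=> e0 /cvgr0Pnorm_le ecv; apply/cvgr0Pnorm_le => eps eps0.
have [N0 _ hN0] := ecv _ (divr_gt0 eps0 (ltr0Sn _ 1)).
set A := \sum_(k < N0) log_gap k * e k.
have A0 : 0 <= A by apply: sumr_ge0 => k _; rewrite mulr_ge0// ltW// log_gap_gt0.
near=> N.
(* Past [N0] the terms are at most eps / 2; the other half of eps absorbs the head [A]. The summand
   1 ensures that [log_node N] is positive. *)
have xN : 2 * A / eps + 1 <= x_ N by near: N; move/cvgryPge : log_node_cvgy; exact.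
have xN0 : 0 < x_ N by rewrite (lt_le_trans _ xN)// ltr_wpDl// divr_ge0 ?mulr_ge0// ltW.
have NN : (N0 <= N)%N by near: N; exact: nbhs_infty_ge.
have s0 : 0 <= \sum_(k < N) log_gap k * e k.
  by apply: sumr_ge0 => k _; rewrite mulr_ge0// ltW// log_gap_gt0.
rewrite ger0_norm ?divr_ge0 ?log_node_ge0// ler_pdivrMr//.
have hs : \sum_(k < N) log_gap k * e k <= A + eps / 2 * x_ N.
  rewrite -(big_mkord xpredT (fun k => log_gap k * e k)) (big_cat_nat _ NN)//= big_mkord lerD//.
  rewrite -sum_log_gap mulr_sumr -(big_mkord xpredT (fun k => eps / 2 * log_gap k)).
  rewrite (big_cat_nat (n := N0) (leq0n _) NN)//= ler_wpDl//.
    by apply: sumr_ge0 => k _; rewrite mulr_ge0 ?divr_ge0// ltW// log_gap_gt0.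
  rewrite big_nat_cond [leRHS]big_nat_cond; apply: ler_sum => k /andP[/andP[kN _] _].
  rewrite mulrC; apply: ler_wpM2r; first exact: ltW (log_gap_gt0 k).
  by have /= := hN0 k kN; rewrite (ger0_norm (e0 k)).
have : 2 * A <= eps * x_ N.
  have : 2 * A / eps <= x_ N by move: xN; lra.
  by rewrite ler_pdivrMr// [x_ N * _]mulrC.
move: hs; lra.
Unshelve. all: end_near. Qed.

(* Z(N) = o(log N), the denominator being [log_node N = log (N + 1)]. *)
Definition olog (Z : nat -> R[i]) := normc (Z N) / x_ N @[N --> \oo] --> 0.

Lemma olog_le (Z : nat -> R[i]) (f : nat -> R) : f N / x_ N @[N --> \oo] --> 0 ->
  (forall N, normc (Z N) <= f N) -> olog Z.
Proof.
move=> f0 Zf; apply: (@squeeze_cvgr _ _ _ _ (cst 0) (fun N => f N / x_ N)) => //.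
  apply: nearW => N /=; rewrite divr_ge0 ?normc_ge0 ?log_node_ge0//=.
  by rewrite ler_wpM2r ?invr_ge0 ?log_node_ge0.
exact: cvg_cst.
Qed.

Lemma olog_bounded (Z : nat -> R[i]) M : (forall N, normc (Z N) <= M) -> olog Z.
Proof.
apply: (olog_le (f := fun=> M)).
have xV : (x_ N)^-1 @[N --> \oo] --> 0.
  apply/gtr0_cvgV0; last exact: log_node_cvgy.
  by exists 1%N => // N /= N1; rewrite -log_node0 ltNge le_log_node -ltnNge.
by have := cvgM (cvg_cst M) xV; rewrite mulr0; exact.
Qed.

Lemma ologD Y Z : olog Y -> olog Z -> olog (fun N => Y N + Z N).
Proof.
move=> hY hZ; apply: (olog_le (f := fun N => normc (Y N) + normc (Z N))).
  under eq_fun do rewrite mulrDl.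
  by have := cvgD hY hZ; rewrite addr0; exact.
by move=> N; exact: normc_triangle.
Qed.

Lemma ologZ q Z : olog Z -> olog (fun N => q * Z N).
Proof.
move=> hZ; apply: (olog_le (f := fun N => normc q * normc (Z N))).
  under eq_fun do rewrite -mulrA.
  by have := cvgM (cvg_cst (normc q)) hZ; rewrite mulr0; exact.
by move=> N; rewrite Normc.normcM.
Qed.

Lemma olog_average (U e : nat -> R[i]) : (forall k, normc (U k) <= 1) ->
  normc (e k) @[k --> \oo] --> 0 ->
  olog (fun N => \sum_(k < N) (log_gap k)%:C%C * (U k * e k)).
Proof.
move=> U1 e0; apply: (olog_le (f := fun N => \sum_(k < N) log_gap k * normc (e k))).
  by apply: (log_average (e := fun k => normc (e k))) => // k; exact: normc_ge0.
move=> N; rewrite (le_trans (normc_sum _ _ _))//; apply: ler_sum => k _.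
rewrite Normc.normcM normc_real (ger0_norm (ltW (log_gap_gt0 k))).
apply: ler_wpM2l; first exact: ltW (log_gap_gt0 k).
rewrite Normc.normcM.
by rewrite ler_piMl ?normc_ge0.
Qed.

(** Convergence by components reduces complex limits to the rules for real ones. *)
Definition ccvg (f : nat -> R[i]) (l : R[i]) :=
  Re (f k) @[k --> \oo] --> Re l /\ Im (f k) @[k --> \oo] --> Im l.

Lemma ccvgM f g l l' : ccvg f l -> ccvg g l' -> ccvg (fun k => f k * g k) (l * l').
Proof.
move=> [f1 f2] [g1 g2]; split.
  under eq_fun do rewrite ReM.
  by rewrite ReM; exact: (cvgB (cvgM f1 g1) (cvgM f2 g2)).
under eq_fun do rewrite ImM.
by rewrite ImM; exact: (cvgD (cvgM f1 g2) (cvgM f2 g1)).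
Qed.

Lemma ReJ (z : R[i]) : Re (conjc z) = Re z. Proof. by case: z. Qed.
Lemma ImJ (z : R[i]) : Im (conjc z) = - Im z. Proof. by case: z. Qed.

Lemma ccvgJ f l : ccvg f l -> ccvg (fun k => conjc (f k)) (conjc l).
Proof.
move=> [f1 f2]; split.
  by under eq_fun do rewrite ReJ; rewrite ReJ.
by under eq_fun do rewrite ImJ; rewrite ImJ; exact: cvgN.
Qed.

Lemma ccvg_real (f : nat -> R) (l : R) : f k @[k --> \oo] --> l -> ccvg (fun k => (f k)%:C%C) l%:C%C.
Proof. by move=> fl; split => //=; exact: cvg_cst. Qed.

Lemma ccvg_normc f l : ccvg f l -> normc (f k - l) @[k --> \oo] --> 0.
Proof.
move=> [f1 f2]; apply: (@squeeze_cvgr _ _ _ _ (cst 0)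
    (fun k => `|Re (f k) - Re l| + `|Im (f k) - Im l|)).
- apply: nearW => k /=; rewrite normc_ge0/= (le_trans (normc_le _))// lerD//.
  + by case: (f k) (l) => ? ? [].
  + by case: (f k) (l) => ? ? [].
- exact: cvg_cst.
- have h (u : nat -> R) a : u k @[k --> \oo] --> a -> `|u k - a| @[k --> \oo] --> 0.
    by move=> /subr_cvg0 /cvg_norm; rewrite normr0.
  by have := cvgD (h _ _ f1) (h _ _ f2); rewrite addr0; exact.
Qed.

(** The difference quotient at 0 along a sequence; as [d k] is never 0, the sequence converges in
    the punctured neighbourhoods of 0. *)
Lemma is_derive0_quotient (f : R -> R) (l : R) (d : nat -> R) : is_derive (0 : R) 1 f l -> f 0 = 0 ->
  (forall k, d k != 0) -> d k @[k --> \oo] --> 0 -> f (d k) / d k @[k --> \oo] --> l.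
Proof.
move=> [/= fd fl] f0 d0 dcv; move: fd; rewrite /derivable => /cvgP; rewrite -/(derive _ _ _) fl.
move=> /cvgr_dnbhsP /(_ d (conj d0 dcv)).
by under eq_fun do rewrite f0 subr0 /GRing.scale/= mulr1 addr0 mulrC.
Qed.

(** With d = log((k+1)/k), this is what remains of k^(-z) - (k+1)^(-z) after division by d k^(-z).
    It tends to z. *)
Definition cexp_quotient (z : R[i]) (d : R) : R[i] := (1 - cexp (- z * d%:C%C)) / d%:C%C.

Lemma cexp_quotient_cvg z : ccvg (fun k => cexp_quotient z (log_gap k)) z.
Proof.
have d0 k : log_gap k != 0 by rewrite gt_eqF// log_gap_gt0.
have E d : d != 0 -> cexp_quotient z d =
    ((1 - expR (- Re z * d) * cos (d * Im z)) / d +i* (expR (- Re z * d) * sin (d * Im z) / d))%C.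
  move=> dn0; rewrite /cexp_quotient -fmorphV; case: z => a b.
  apply/eqP; rewrite eq_complex /= !mulr0 !subr0 !add0r !mulNr !cosN !sinN.
  by apply/andP; split; apply/eqP; rewrite ?[b * d]mulrC; ring.
have de x := is_derive_expM (- Re z) x.
have h1 : is_derive (0 : R) 1 (fun d => 1 - expR (- Re z * d) * cos (d * Im z)) (Re z).
  have h := is_deriveB (is_derive_cst (1 : R) (0 : R) 1) (is_deriveM (de 0) (is_derive_cosM (Im z) 0)).
  apply: is_derive_eq h _.
  by rewrite /GRing.scale/= mulr0 mul0r expR0 cos0 sin0; ring.
have h2 : is_derive (0 : R) 1 (fun d => expR (- Re z * d) * sin (d * Im z)) (Im z).
  have h := is_deriveM (de 0) (is_derive_sinM (Im z) 0).
  apply: is_derive_eq h _.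
  by rewrite /GRing.scale/= mulr0 mul0r expR0 cos0 sin0; ring.
split.
- under eq_fun do rewrite E//=.
  apply: (is_derive0_quotient h1) => //; last exact: log_gap_cvg.
  by rewrite mulr0 mul0r expR0 cos0 mul1r subrr.
- under eq_fun do rewrite E//=.
  apply: (is_derive0_quotient h2) => //; last exact: log_gap_cvg.
  by rewrite mul0r sin0 mulr0.
Qed.

Lemma exp_quotient_cvg (a : R) : a != 0 ->
  a / ((1 - expR (- a * log_gap k)) / log_gap k) @[k --> \oo] --> (1 : R).
Proof.
move=> a0; suff h : (1 - expR (- a * log_gap k)) / log_gap k @[k --> \oo] --> a.
  by have := cvgM (cvg_cst a) (cvgV a0 h); rewrite mulfV//; exact.
apply: (@is_derive0_quotient (fun d => 1 - expR (- a * d))); last exact: log_gap_cvg.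
- have h := is_deriveB (is_derive_cst (1 : R) (0 : R) 1) (is_derive_expM (- a) 0).
  by apply: is_derive_eq h _; rewrite mulr0 expR0; ring.
- by rewrite mulr0 expR0 subrr.
- by move=> k; rewrite gt_eqF// log_gap_gt0.
Qed.

End logarithmic_averages.

(** * Entries of the Gram matrix *)

Section gram.
Context {R : realType}.
Local Notation Re := complex.Re.
Local Notation Im := complex.Im.
Local Notation normc := Normc.normc.
Local Notation x_ := (@log_node R).
Local Notation d_ := (@log_gap R).
Variable c : R.
Hypothesis c0 : 0 < c.
Implicit Types t tau : R.

Definition gram n t t' : R[i] :=
  \sum_(j < n) node_diff n (c +i* t)%C j * (node_diff n (c +i* t')%C j)^*%C /
    (weight n c j)%:C%C.

(** The number (k+1)^(-i tau). *)
Definition phase tau k : R[i] := cexp (- (0 +i* tau)%C * (x_ k)%:C%C).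

Lemma normc_phase tau k : normc (phase tau k) = 1.
Proof. by rewrite normc_cexp /= !(oppr0, mul0r, mulr0, subr0) expR0. Qed.

Lemma cexp_log_gap (s : R[i]) k : cexp (- s * (x_ k)%:C%C) - cexp (- s * (x_ k.+1)%:C%C) =
  cexp (- s * (x_ k)%:C%C) * ((d_ k)%:C%C * cexp_quotient s (d_ k)).
Proof.
have dC : (d_ k)%:C%C != 0 :> R[i].
  by rewrite -(rmorph0 (real_complex R)) (inj_eq (@complexI R)) gt_eqF// log_gap_gt0.
rewrite /cexp_quotient [(d_ k)%:C%C * (_ / _)]mulrC divfK// mulrBr mulr1 -cexpD.
congr (_ - cexp _); rewrite -mulrDr -rmorphD /=; congr (_ * _%:C%C).
by rewrite /log_gap addrC subrK.
Qed.

Lemma cexp_mulJ t t' k :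
  cexp (- (c +i* t)%C * (x_ k)%:C%C) * (cexp (- (c +i* t')%C * (x_ k)%:C%C))^*%C =
  (expR (- (2 * c) * x_ k))%:C%C * phase (t - t') k.
Proof.
rewrite conjc_cexp -cexpD (_ : (expR (- (2 * c) * x_ k))%:C%C = cexp (- (2 * c) * x_ k)%:C%C); last first.
  by rewrite /cexp /= cos0 sin0 mulr1 mulr0.
rewrite -cexpD; congr cexp; apply/eqP; rewrite eq_complex /=.
by apply/andP; split; apply/eqP; ring.
Qed.

(** Before the last index this is [log_gap k] times (k+1)^(-2c) over the weight; it tends to 1. *)
Definition weight_quotient k : R :=
  2 * c / ((1 - expR (- (2 * c) * d_ k)) / d_ k).

(** The numerator has two factors [log_gap k] and the weight is of the order of one, so one
    survives; the powers (k+1)^(-2c) cancel. *)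
Lemma gram_term N t t' k : (k < N)%N ->
  node_diff N.+1 (c +i* t)%C k * (node_diff N.+1 (c +i* t')%C k)^*%C /
    (weight N.+1 c k)%:C%C =
  (d_ k)%:C%C * (phase (t - t') k *
    (cexp_quotient (c +i* t)%C (d_ k) * (cexp_quotient (c +i* t')%C (d_ k))^*%C *
     (weight_quotient k)%:C%C)).
Proof.
move=> kN; rewrite /node_diff /weight ltnS kN !cexp_log_gap.
move: (cexp_quotient (c +i* t)%C _) (cexp_quotient (c +i* t')%C _) => P Q0.
rewrite !conjcM conjc_real; move: (conjc Q0) => Q {Q0}.
have aux (A B D P' Q' W : R[i]) :
  A * (D * P') * (B * (D * Q')) / W = A * B * (D ^+ 2 * (P' * Q')) / W by ring.
rewrite aux {aux}.
rewrite cexp_mulJ.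
have d0 : 0 < d_ k := log_gap_gt0 k; have e0 := expR_gt0 (- (2 * c) * x_ k).
have -> : expR (- (2 * c) * x_ k.+1) = expR (- (2 * c) * x_ k) * expR (- (2 * c) * d_ k).
  by rewrite -expRD; congr expR; rewrite /log_gap; ring.
have g0 : 0 < 1 - expR (- (2 * c) * d_ k).
  by rewrite subr_gt0 expR_lt1 mulNr oppr_lt0 !mulr_gt0 ?log_gap_gt0.
rewrite /weight_quotient; set E := expR _ in e0 *; set g := expR _ in g0 *.
have -> : (E - E * g) / (2 * c) = E * (1 - g) / (2 * c) by rewrite mulrBr mulr1.
set D := d_ k in d0 *; set V := phase _ _.
have C0 (r : R) : 0 < r -> r%:C%C != 0 :> R[i].
  by move=> r0; rewrite -(rmorph0 (real_complex R)) (inj_eq (@complexI R)) gt_eqF.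
have -> : (E * (1 - g) / (2 * c))%:C%C = E%:C%C * (1 - g)%:C%C / (2 * c)%:C%C.
  by rewrite -!rmorphM -fmorphV -rmorphM.
have -> : (2 * c / ((1 - g) / D))%:C%C = (2 * c)%:C%C / ((1 - g)%:C%C / D%:C%C).
  by rewrite -!fmorphV -!rmorphM -!fmorphV -!rmorphM.
have := C0 _ d0; have := C0 _ e0; have := C0 _ g0.
have : (2 * c)%:C%C != 0 :> R[i] by apply: C0; rewrite mulr_gt0.
move: (D%:C%C) (E%:C%C) ((1 - g)%:C%C) ((2 * c)%:C%C) => D' E' g' c' h1 h2 h3 h4.
by field; rewrite h1 h2 h3 h4.
Qed.

(** The cut-off term stays bounded, hence is negligible against log N. *)
Lemma gram_last N t t' :
  node_diff N.+1 (c +i* t)%C N * (node_diff N.+1 (c +i* t')%C N)^*%C /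
    (weight N.+1 c N)%:C%C = (2 * c)%:C%C * phase (t - t') N.
Proof.
rewrite /node_diff /weight ltnn !subr0 cexp_mulJ.
set E := expR _; have -> : (E / (2 * c))%:C%C = E%:C%C / (2 * c)%:C%C.
  by rewrite -fmorphV -rmorphM.
have e0 := expR_gt0 (- (2 * c) * x_ N).
have C0 (r : R) : 0 < r -> r%:C%C != 0 :> R[i].
  by move=> r0; rewrite -(rmorph0 (real_complex R)) (inj_eq (@complexI R)) gt_eqF.
have := C0 _ e0; have := C0 (2 * c); rewrite mulr_gt0// => /(_ isT).
rewrite -/E; move: (E%:C%C) ((2 * c)%:C%C) (phase _ _) => E' c' V h1 h2.
by field; rewrite h1 h2.
Qed.

(* The increments phase k - phase (k+1) telescope and equal
   (d_ k) * (i tau + o(1)) * phase k. *)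
Lemma phase_average tau : tau != 0 -> olog (fun N => \sum_(k < N) (d_ k)%:C%C * phase tau k).
Proof.
move=> tau0; pose z : R[i] := (0 +i* tau)%C.
have z0 : z != 0 by rewrite eq_complex /= negb_and tau0 orbT.
pose e k := cexp_quotient z (d_ k) - z.
have he : normc (e k) @[k --> \oo] --> 0 by exact: ccvg_normc (cexp_quotient_cvg z).
have E N : \sum_(k < N) (d_ k)%:C%C * phase tau k =
    z^-1 * ((1 - phase tau N) + (-1) * \sum_(k < N) (d_ k)%:C%C * (phase tau k * e k)).
  have -> : 1 - phase tau N = \sum_(k < N) (phase tau k - phase tau k.+1).
    rewrite -(big_mkord xpredT (fun k => phase tau k - phase tau k.+1)).
    under eq_bigr do rewrite -opprB.
    by rewrite sumrN telescope_sumr// opprB /phase log_node0 mulr0 cexp0.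
  rewrite mulr_sumr -big_split mulr_sumr; apply: eq_bigr => k _ /=.
  rewrite {2 3}/phase cexp_log_gap -/(phase tau k) /e -/z.
  by field.
rewrite (_ : (fun N => _) = (fun N => z^-1 * ((1 - phase tau N) +
   (-1) * \sum_(k < N) (d_ k)%:C%C * (phase tau k * e k)))); last exact/funext.
apply: ologZ; apply: ologD.
  apply: (olog_bounded (M := 2)) => N.
  rewrite (le_trans (normc_triangle _ _))// normc_opp normc_phase.
  by rewrite Normc.normc1.
by apply: ologZ; apply: olog_average => // k; rewrite normc_phase.
Qed.

(** Up to o(log N) the entry is q times the sum of the gaps against the phases. For t = t' the
    phases are 1, the gaps add up to [log_node N] and q = c^2 + t^2; otherwise [phase_average]
    applies. *)
Lemma gram_olog t t' : olog (fun N => gram N.+1 t t' -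
  (if t == t' then c ^+ 2 + t ^+ 2 else 0)%:C%C * (x_ N)%:C%C).
Proof.
pose q : R[i] := (c +i* t)%C * ((c +i* t')^*)%C.
pose f k := cexp_quotient (c +i* t)%C (d_ k) * (cexp_quotient (c +i* t')%C (d_ k))^*%C *
     (weight_quotient k)%:C%C.
have hf : normc (f k - q) @[k --> \oo] --> 0.
  apply: ccvg_normc; rewrite -[q]mulr1; apply: ccvgM.
    by apply: ccvgM; [|apply: ccvgJ]; exact: cexp_quotient_cvg.
  have c2 : 2 * c != 0 by rewrite mulf_neq0 ?(gt_eqF c0).
  exact: (ccvg_real (exp_quotient_cvg c2)).
have E N : gram N.+1 t t' =
  \sum_(k < N) (d_ k)%:C%C * (phase (t - t') k * (f k - q)) +
   ((2 * c)%:C%C * phase (t - t') N + q * \sum_(k < N) (d_ k)%:C%C * phase (t - t') k).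
  rewrite /gram big_ord_recr /= gram_last addrCA [RHS]addrC; congr (_ + _).
  rewrite mulr_sumr -big_split; apply: eq_bigr => k _ /=.
  by rewrite gram_term// -/(f k); ring.
have h1 : olog (fun N => \sum_(k < N) (d_ k)%:C%C * (phase (t - t') k * (f k - q))).
  by apply: (olog_average (U := phase (t - t')) (e := fun k => f k - q)) => // k; rewrite normc_phase.
have h2 : olog (fun N => (2 * c)%:C%C * phase (t - t') N).
  by apply: ologZ; apply: (olog_bounded (M := 1)) => N; rewrite normc_phase.
have [tt'|tt'] := eqVneq t t'.
  have p1 k : phase (t - t') k = 1.
    by rewrite /phase tt' subrr (_ : (0 +i* 0)%C = 0 :> R[i])// oppr0 mul0r cexp0.
  rewrite (_ : (fun N => _) = (fun N => \sum_(k < N) (d_ k)%:C%C * (phase (t - t') k * (f k - q)) +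
     (2 * c)%:C%C * phase (t - t') N)); first exact: ologD.
  apply/funext => N; rewrite E.
  have -> : \sum_(k < N) (d_ k)%:C%C * phase (t - t') k = (x_ N)%:C%C.
    rewrite -sum_log_gap rmorph_sum; apply: eq_bigr => k _.
    by rewrite p1 mulr1.
  have -> : q = (c ^+ 2 + t ^+ 2)%:C%C.
    rewrite /q -tt'; apply/eqP; rewrite eq_complex /=.
    by apply/andP; split; apply/eqP; ring.
  by rewrite addrA addrK.
rewrite (_ : (fun N => _) = (fun N => \sum_(k < N) (d_ k)%:C%C * (phase (t - t') k * (f k - q)) +
   ((2 * c)%:C%C * phase (t - t') N + q * \sum_(k < N) (d_ k)%:C%C * phase (t - t') k))).
  apply: ologD => //; apply: ologD => //; apply: ologZ; apply: phase_average.
  by rewrite subr_eq0.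
by apply/funext => N; rewrite E mul0r subr0.
Qed.

End gram.

(** * The minimum *)

Section minimum.
Context {R : realType}.
Local Notation Re := complex.Re.
Local Notation normc := Normc.normc.
Variables (p : R) (m : nat) (t : 'I_m -> R).
Hypothesis p0 : 0 < p.
Let c := p^-1.
Let c0 : 0 < c. Proof. by rewrite invr_gt0. Qed.

(** [minimizer_pythagoras] transported to Dirichlet polynomials through their partial sums. *)
Lemma unique_minimum n (lam : 'I_m -> R[i]) :
  (forall i, \sum_l lam l * gram c n (t i) (t l) = 1) ->
  dist2 p t n = (Re (\sum_l lam l))%:E /\
  exists! B : R[i] -> R[i], dirichlet_interp p t n B /\ energy p B = dist2 p t n.
Proof.
move=> lamG; set E := Re _.
pose a i j := node_diff n (c +i* t i)%C j.
pose w := weight n c.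
have w0 j : 0 < w j by exact: weight_gt0.
pose T := minimizer w a lam.
have [b0 b0T] := partial_coef_surj n T.
pose B0 := dirichlet_poly n b0.
have feas b : (forall i, dirichlet_poly n b (c +i* t i)%C = 1) ->
    forall i, \sum_(j < n) partial_coef n b j * a i j = 1.
  by move=> h i; rewrite -(h i) dirichlet_poly_partial.
have B0i : dirichlet_interp p t n B0.
  split; first by exists b0.
  move=> i; rewrite /B0 dirichlet_poly_partial -[RHS](minimizer_feasible (w := w) (a := a) lamG i).
  by apply: eq_bigr => j _; rewrite b0T.
have enB b : (forall i, dirichlet_poly n b (c +i* t i)%C = 1) ->
    energy p (dirichlet_poly n b) =
    (E + \sum_(j < n) w j * normc (partial_coef n b j - T j) ^+ 2)%:E.
  move=> h; rewrite energy_dirichlet_poly//.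
  by rewrite (minimizer_pythagoras w0 lamG (feas b h)).
have enB0 : energy p B0 = E%:E.
  rewrite enB; last exact: B0i.2.
  rewrite big1 ?addr0// => j _.
  by rewrite b0T// subrr Normc.normc0 expr0n mulr0.
have dE : dist2 p t n = E%:E.
  apply/eqP; rewrite eq_le; apply/andP; split.
    by rewrite -enB0; apply: ereal_inf_lbound; exists B0.
  apply: le_ereal_inf_tmp => _ [B [[b ->] hB] <-].
  rewrite enB// lee_fin lerDl; apply: sumr_ge0 => j _.
  by rewrite mulr_ge0 ?sqr_ge0// ltW.
split=> //; exists B0; split; first by rewrite dE.
(* Equal energy makes the excess vanish; the weights being positive, all partial sums agree with
   [T], hence so do the functions. *)
move=> B [[[b ->] hB]]; rewrite dE enB// => -[/eqP].
rewrite -[X in _ == X]addr0 (inj_eq (addrI E)) => /eqP h.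
apply/funext => s; rewrite /B0 !dirichlet_poly_partial; apply: eq_bigr => j _.
have /psumr_eq0P/(_ j isT)/eqP := h.
rewrite mulf_eq0 (gt_eqF (w0 j)) expf_eq0/= => hj.
rewrite b0T//; congr (_ * _); apply/esym/eqP; rewrite -subr_eq0; apply/eqP/Normc.eq0_normc/eqP.
apply: hj => k _; rewrite mulr_ge0 ?sqr_ge0// ltW//.
Qed.

Hypothesis t_inj : injective t.
Hypothesis m0 : (0 < m)%N.
Let d i : R := c ^+ 2 + t i ^+ 2.

(** The Gram matrix divided by [log_node N] is eventually close to the diagonal matrix of the [d i],
    so [solve_near_diagonal] applies. For n = N + 1 this is the asymptotic value of the minimum
    times log n. *)
Lemma gram_solution eps : 0 < eps -> \forall N \near \oo,
  exists lam : 'I_m -> R[i],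
    (forall i, \sum_l lam l * gram c N.+1 (t i) (t l) = 1) /\
    `|\sum_i (d i)^-1 - Re (\sum_l lam l) * log_node N| <= eps.
Proof.
move=> eps0; pose d0 := c ^+ 2; have d00 : 0 < d0 by rewrite exprn_gt0.
have mR : 0 < m%:R :> R by rewrite ltr0n.
(* The first bound meets the smallness condition m e <= d0 / 2; the second keeps the sum of the m
   errors below eps. *)
pose e := Num.min (d0 / 2 / m%:R) (eps * d0 ^+ 2 / (2 * m%:R ^+ 2)).
have e0 : 0 < e by rewrite lt_min !divr_gt0 ?mulr_gt0 ?exprn_gt0.
have me1 : m%:R * e <= d0 / 2.
  by rewrite mulrC -ler_pdivlMr// ge_min lexx.
have me2 : m%:R * (e * (2 * m%:R / d0) / d0) <= eps.
  have : e <= eps * d0 ^+ 2 / (2 * m%:R ^+ 2) by rewrite ge_min lexx orbT.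
  rewrite ler_pdivlMr ?mulr_gt0 ?exprn_gt0// => h.
  rewrite (_ : _ * _ = e * (2 * m%:R ^+ 2) / d0 ^+ 2); last by field; rewrite (gt_eqF d00).
  by rewrite ler_pdivrMr ?exprn_gt0.
have near_gram : \forall N \near \oo, forall il : 'I_m * 'I_m,
    normc (gram c N.+1 (t il.1) (t il.2) -
      (if il.1 == il.2 then d il.1 else 0)%:C%C * (@log_node R N)%:C%C) / log_node N <= e.
  apply: filter_forall => -[i l] /=.
  have := gram_olog c0 (t i) (t l); rewrite (inj_eq t_inj) => /cvgr0Pnorm_le/(_ _ e0).
  by apply: filterS => N /=; exact: le_trans (ler_norm _).
near=> N.
have x0 : 0 < log_node N :> R.
  by rewrite -log_node0 ltNge le_log_node -ltnNge; near: N; exists 1%N.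
have hN : forall il : 'I_m * 'I_m,
    normc (gram c N.+1 (t il.1) (t il.2) -
      (if il.1 == il.2 then d il.1 else 0)%:C%C * (@log_node R N)%:C%C) / log_node N <= e.
  by near: N.
have xC : (@log_node R N)%:C%C != 0 :> R[i].
  by rewrite -(rmorph0 (real_complex R)) (inj_eq (@complexI R)) gt_eqF.
have [] := @solve_near_diagonal R m (fun i l => gram c N.+1 (t i) (t l) / (log_node N)%:C%C) d d0 e.
- exact: d00.
- by move=> i; rewrite lerDl sqr_ge0.
- exact: ltW.
- exact: me1.
- move=> i l; have /= := hN (i, l); apply: le_trans.
  move: ((if i == l then d i else 0)%:C%C) => D.
  have -> : gram c N.+1 (t i) (t l) / (log_node N)%:C%C - D =
      (gram c N.+1 (t i) (t l) - D * (log_node N)%:C%C) / (log_node N)%:C%C.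
    by rewrite mulrBl mulfK.
  by rewrite Normc.normcM Normc.normcV normc_real (gtr0_norm x0).
(* Undoes the normalization of the Gram matrix by [log_node N]. *)
move=> v [hv vd]; exists (fun l => v l / (log_node N)%:C%C); split.
  by move=> i; rewrite -(hv i); apply: eq_bigr => l _; rewrite mulrAC mulrA.
rewrite -mulr_suml.
have -> : Re ((\sum_l v l) / (log_node N)%:C%C) * log_node N = Re (\sum_l v l).
  by rewrite -fmorphV ReM /= mulr0 subr0 -mulrA mulVf ?mulr1// gt_eqF.
rewrite Re_sum -sumrB; apply: le_trans me2.
apply: (le_trans (ler_norm_sum _ _ _)).
have -> : m%:R * (e * (2 * m%:R / d0) / d0) = \sum_(l < m) (e * (2 * m%:R / d0) / d0).
  by rewrite sumr_const card_ord mulr_natl.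
apply: ler_sum => l _.
apply: le_trans (vd l); rewrite -normrN opprB.
rewrite -(@ler_pXn2r _ 2) ?nnegrE ?normc_ge0// sqr_normcE real_normK ?num_real//.
by case: (v l) => x y /=; rewrite lerDl sqr_ge0.
Unshelve. all: end_near. Qed.

End minimum.

Theorem theorem3 (R : realType) (p : R) (m : nat) (t : 'I_m -> R)
    (hp1 : 1 < p) (hp2 : p <= 2) (hm : (0 < m)%N) (ht : injective t) :
  (exists N : nat, forall n : nat, (N < n)%N ->
     exists! B : R[i] -> R[i],
       dirichlet_interp p t n B /\ energy p B = dist2 p t n) /\
  asymp_equiv (dist2 p t)
    (fun n : nat =>
       1 / ln (n%:R : R) * \sum_(j < m) 1 / (1 / p ^+ 2 + t j ^+ 2)).
Proof.
have p0 : 0 < p by rewrite (lt_trans ltr01).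
split.
  have [N0 _ hN0] := gram_solution p0 ht hm (ltr01 : 0 < 1 :> R).
  (* The length is [n.+1] while [gram_solution] is indexed by [n], hence the threshold [N0.+1]. *)
  exists N0.+1 => -[//|n]; rewrite ltnS => /ltnW /hN0 [lam [hlam _]].
  by have [] := unique_minimum p0 hlam.
set s := \sum_(j < m) _.
have sE : s = \sum_i (p^-1 ^+ 2 + t i ^+ 2)^-1.
  by apply: eq_bigr => i _; rewrite !div1r exprVn.
have s0 : 0 < s.
  rewrite sE (bigD1 (Ordinal hm))//= ltr_pwDl//.
    by rewrite invr_gt0 add_sqr_gt0// invr_gt0.
  by apply: sumr_ge0 => i _; rewrite invr_ge0 ltW// add_sqr_gt0// invr_gt0.
(* Passing to n = N + 1 turns log n into [log_node N]; finiteness is shown first, then the real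
   limit. *)
rewrite /asymp_equiv -cvg_shiftS /=; apply/fine_cvgP; split.
  have := gram_solution p0 ht hm (ltr01 : 0 < 1 :> R); apply: filterS => N [lam [hlam _]].
  by have [-> _] := unique_minimum p0 hlam.
apply/cvgrPdist_le => eps eps0.
(* The tolerance is [eps * s] because the error is divided by [s] in the ratio. *)
have := gram_solution p0 ht hm (mulr_gt0 eps0 s0); apply: filterS => N [lam [hlam h]].
rewrite /=; have [-> _] := unique_minimum p0 hlam.
rewrite /= -sE -/(@log_node R N) in h *.
rewrite div1r invfM invrK.
rewrite (_ : 1 - _ = (s - complex.Re (\sum_l lam l) * log_node N) / s); last first.
  by rewrite mulrBl mulfV ?gt_eqF// mulrA.
by rewrite normrM normfV (gtr0_norm s0) ler_pdivrMr.
Qed.
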